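(* Let $A$ be a commutative monotone $\sigma$-complete $C^*$-algebra, let $B$ be a $C^*$-algebra (not necessarily commutative), and let $\phi: A\to B$ be a $\sigma$-normal morphism. Then $\phi(A)$ is a commutative monotone $\sigma$-complete $C^*$-algebra, and $\phi(A)$ is a monotone $\sigma$-closed $C^*$-subalgebra of $B$.
   Context: $C^*$-algebras are over $\mathbb{C}$ and are not necessarily unital. A morphism of $C^*$-algebras is a $*$-homomorphism; it is not required to be unital (even when both algebras are). Self-adjoint elements are ordered by $a\leq b$ iff $b-a$ is positive. A sequence is bounded if it is bounded in norm. A supremum in a $C^*$-algebra $A$ of a sequence of self-adjoint elements means a least upper bound in the partially ordered set of self-adjoint elements of $A$. (1) A $C^*$-algebra $A$ is monotone $\sigma$-complete if every bounded increasing sequence of self-adjoint elements of $A$ has a supremum in $A$. (2) A $C^*$-subalgebra $A$ of a $C^*$-algebra $B$ is a monotone $\sigma$-closed $C^*$-subalgebra of $B$ if, whenever $a_1\leq a_2\leq\ldots$ is a bounded increasing sequence of self-adjoint elements of $A$ which has a supremum $\sup^B_{n\geq 1}a_n$ in $B$, one has $\sup^B_{n\geq 1}a_n\in A$. (3) A morphism $\phi:A\to B$ between $C^*$-algebras is $\sigma$-normal if for each bounded increasing sequence $a_1\leq a_2\leq\ldots$ of self-adjoint elements of $A$ which has a supremum in $A$, the supremum of the sequence $(\phi(a_n))_{n\ge 1}$ in $B$ exists and $\phi(\sup_{n\geq 1}a_n)=\sup_{n\geq 1}\phi(a_n)$. *)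

(* Defs.v *)
From HB Require Import structures.
From mathcomp Require Import all_boot all_order all_algebra.
From mathcomp Require Import all_classical all_reals all_analysis.
From mathcomp Require Import complex.

Set Implicit Arguments.
Unset Strict Implicit.
Unset Printing Implicit Defensive.

Import Order.TTheory GRing.Theory Num.Theory.
Import numFieldNormedType.Exports.

Local Open Scope classical_set_scope.
Local Open Scope ring_scope.

(** The complex numbers are [R[i]] with [R : realType]; the norm of a
    [normedModType R[i]] takes its values in the nonnegative elements of
    [R[i]], on which the order of [R[i]] restricts to that of [R]. *)

HB.mixin Record isCStarAlgebra (R : realType) A
    & CompleteNormedModule R[i] A := {
  cmul : A -> A -> A;
  star : A -> A;
  cmulA : forall x y z : A, cmul x (cmul y z) = cmul (cmul x y) z;
  cmulDl : forall x y z : A, cmul (x + y) z = cmul x z + cmul y z;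
  cmulDr : forall x y z : A, cmul x (y + z) = cmul x y + cmul x z;
  cmulZl : forall (a : R[i]) (x y : A), cmul (a *: x) y = a *: cmul x y;
  cmulZr : forall (a : R[i]) (x y : A), cmul x (a *: y) = a *: cmul x y;
  starK : forall x : A, star (star x) = x;
  starD : forall x y : A, star (x + y) = star x + star y;
  starZ : forall (a : R[i]) (x : A), star (a *: x) = conjc a *: star x;
  starM : forall x y : A, star (cmul x y) = cmul (star y) (star x);
  cnormM : forall x y : A, `|cmul x y| <= `|x| * `|y|;
  cnorm_star : forall x : A, `|cmul (star x) x| = `|x| ^+ 2
}.

#[short(type="cstarAlgType")]
HB.structure Definition CStarAlgebra (R : realType) :=
  {A of CompleteNormedModule R[i] A & isCStarAlgebra R A}.

Reserved Notation "x ** y" (at level 40, left associativity).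
Notation "x ** y" := (cmul x y) : ring_scope.

(** The unitization of [A] is [A * R[i]], the pair [(a, z)] standing for
    [a + z 1]. *)
Definition unitization (R : realType) (A : cstarAlgType R) : Type :=
  (A * R[i])%type.

Section Unitization.
Context {R : realType} {A : cstarAlgType R}.

HB.instance Definition _ := GRing.Lmodule.copy (unitization A) (A * R[i]^o)%type.

Definition umul (x y : unitization A) : unitization A :=
  (x.1 ** y.1 + y.2 *: x.1 + x.2 *: y.1, x.2 * y.2).

Definition uone : unitization A := (0, 1).

Definition uinj (a : A) : unitization A := (a, 0).

Let cmul0x (x : A) : 0 ** x = 0.
Proof. by have := cmulZl 0 0 x; rewrite !scale0r. Qed.

Let cmulx0 (x : A) : x ** 0 = 0.
Proof. by have := cmulZr 0 x 0; rewrite !scale0r. Qed.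

Lemma umulA : associative umul.
Proof.
move=> [x a] [y b] [z c]; rewrite /umul /=; congr pair; last by rewrite mulrA.
rewrite !(cmulDl, cmulDr, cmulZl, cmulZr, scalerDr, scalerA) cmulA.
rewrite -!addrA; congr (_ + _).
rewrite [c * a]mulrC [b * c]mulrC [LHS]addrCA; congr (_ + _).
by rewrite [RHS]addrCA; congr (_ + _); exact: addrCA.
Qed.

Lemma umul1 : left_id uone umul.
Proof.
by move=> [x a]; rewrite /umul /= cmul0x scaler0 !add0r scale1r mul1r.
Qed.

Lemma umulr1 : right_id uone umul.
Proof.
by move=> [x a]; rewrite /umul /= cmulx0 scaler0 add0r addr0 scale1r mulr1.
Qed.

Lemma umulDl : left_distributive umul +%R.
Proof.
move=> [x a] [y b] [z c]; rewrite /umul /=; congr pair; last by rewrite mulrDl.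
rewrite cmulDl scalerDr scalerDl [in RHS]addrACA; congr (_ + _).
by rewrite addrACA.
Qed.

Lemma umulDr : right_distributive umul +%R.
Proof.
move=> [x a] [y b] [z c]; rewrite /umul /=; congr pair; last by rewrite mulrDr.
rewrite cmulDr scalerDr scalerDl [in RHS]addrACA; congr (_ + _).
by rewrite addrACA.
Qed.

Lemma uone_neq0 : uone != 0.
Proof. by apply/eqP => -[/eqP]; rewrite oner_eq0. Qed.

HB.instance Definition _ := GRing.Zmodule_isNzRing.Build (unitization A)
  umulA umul1 umulr1 umulDl umulDr uone_neq0.

End Unitization.

Section Order.
Context {R : realType} {A : cstarAlgType R}.
Implicit Types (a b s : A) (u : nat -> A).

(** The spectrum computed in the unitization; when [A] already has a unit, this
    is the spectrum in [A] with [0] adjoined, which is harmless in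
    [cpositive]. *)
Definition spectrum a : set R[i] :=
  [set z | ~ exists y : unitization A,
     let x := uinj a - z *: (1 : unitization A) in x * y = 1 /\ y * x = 1].

Definition selfadjoint a := star a = a.

(** In [R[i]], [0 <= z] means that [z] is real and nonnegative. *)
Definition cpositive a := selfadjoint a /\ forall z, spectrum a z -> 0 <= z.

Definition cle a b := cpositive (b - a).

Definition bounded_increasing_sa u :=
  [/\ forall n, selfadjoint (u n),
      forall n, cle (u n) (u n.+1) &
      bounded_fun u].

Definition is_csup u s :=
  [/\ selfadjoint s,
      forall n, cle (u n) s &
      forall t, selfadjoint t -> (forall n, cle (u n) t) -> cle s t].

End Order.

Definition cstar_commutative (R : realType) (A : cstarAlgType R) :=
  forall x y : A, x ** y = y ** x.

Definition monotone_sigma_complete (R : realType) (A : cstarAlgType R) :=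
  forall u : nat -> A, bounded_increasing_sa u -> exists s, is_csup u s.

Record star_morphism (R : realType) (A B : cstarAlgType R)
    (phi : {linear A -> B}) : Prop := {
  star_morphismM : forall x y, phi (x ** y) = phi x ** phi y;
  star_morphism_star : forall x, phi (star x) = star (phi x)
}.

(** Since [cle] is antisymmetric on self-adjoint elements, [is_csup] says that
    the supremum exists and is the given element. *)
Definition sigma_normal (R : realType) (A B : cstarAlgType R) (phi : A -> B) :=
  forall (u : nat -> A) (s : A),
    bounded_increasing_sa u -> is_csup u s -> is_csup (phi \o u) (phi s).

Record cstarSubalg (R : realType) (B : cstarAlgType R) := CStarSubalg {
  csub_carrier :> set B;
  csub0 : csub_carrier 0;
  csubD : forall x y, csub_carrier x -> csub_carrier y -> csub_carrier (x + y);
  csubZ : forall (a : R[i]) x, csub_carrier x -> csub_carrier (a *: x);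
  csubM : forall x y, csub_carrier x -> csub_carrier y -> csub_carrier (x ** y);
  csub_star : forall x, csub_carrier x -> csub_carrier (star x);
  csub_closed : closed csub_carrier
}.

(** A C*-subalgebra as a C*-algebra in its own right. In particular its order is
    defined from spectra computed in its own unitization. *)
Record csub_type (R : realType) (B : cstarAlgType R) (S : cstarSubalg B) :=
  CSubType { csub_val : B; csub_valP : csub_val \in (S : set B) }.

Section Subalgebra.
Context {R : realType} {B : cstarAlgType R} (S : cstarSubalg B).
Local Notation T := (csub_type S).

HB.instance Definition _ := [isSub for @csub_val R B S].
HB.instance Definition _ := [Choice of T by <:].

Lemma csub_submod_closed : submod_closed (mem (S : set B)).
Proof.
split=> [|a x y]; first by rewrite mem_set//; exact: csub0.
move=> /set_mem Sx /set_mem Sy; rewrite mem_set//.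
by apply: csubD => //; exact: csubZ.
Qed.

HB.instance Definition _ :=
  GRing.SubChoice_isSubLmodule.Build R[i] B (mem (S : set B)) T csub_submod_closed.

Lemma csub_ler_normD (x y : T) : `|val (x + y)| <= `|val x| + `|val y|.
Proof. by rewrite raddfD ler_normD. Qed.

Lemma csub_normrZ (l : R[i]) (x : T) : `|val (l *: x)| = `|l| * `|val x|.
Proof. by rewrite linearZ normrZ. Qed.

Lemma csub_normr0_eq0 (x : T) : `|val x| = 0 -> x = 0.
Proof. by move/normr0_eq0 => x0; apply: val_inj; rewrite x0 raddf0. Qed.

HB.instance Definition _ := Lmodule_isNormed.Build R[i] T
  csub_ler_normD csub_normrZ csub_normr0_eq0.

Lemma csub_valD (x y : T) : csub_val (x + y) = csub_val x + csub_val y.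
Proof. exact: (raddfD val). Qed.

Lemma csub_valZ (a : R[i]) (x : T) : csub_val (a *: x) = a *: csub_val x.
Proof. exact: (linearZZ (val : {linear T -> B})). Qed.

Lemma csub_valB (x y : T) : csub_val (x - y) = csub_val x - csub_val y.
Proof. exact: (raddfB val). Qed.

Lemma csub_complete (F : set_system T) : ProperFilter F -> cauchy F -> cvg F.
Proof.
move=> FF /cauchy_ballP Fc.
have /cauchy_cvg/cvg_ex[l vl] : cauchy (val @ F : set_system B).
  apply/cauchy_ballP => e e0.
  rewrite !near_simpl.
  have := Fc _ e0; rewrite near_simpl.
  apply: filterS => -[x y] /=.
  by rewrite -!ball_normE /ball_ /= -csub_valB.
have Sl : (S : set B) l.
  apply: (closed_cvg _ (@csub_closed _ _ S) _ _ vl).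
  by near=> x; apply/set_mem; exact: csub_valP.
apply/cvg_ex; exists (CSubType (mem_set Sl)).
apply/fcvgrPdist_lt => e e0.
move/cvgrPdist_lt : vl => /(_ _ e0).
apply: filterS => x.
suff -> : `|l - val x| = `|CSubType (mem_set Sl) - x| by [].
by rewrite [RHS]/(`|val _|) raddfB.
Unshelve. all: by end_near. Qed.

HB.instance Definition _ := Uniform_isComplete.Build T csub_complete.

Definition csub_mul (x y : T) : T :=
  CSubType (mem_set (csubM (set_mem (csub_valP x)) (set_mem (csub_valP y)))).

Definition csub_starf (x : T) : T :=
  CSubType (mem_set (csub_star (set_mem (csub_valP x)))).

Lemma csub_mulA x y z : csub_mul x (csub_mul y z) = csub_mul (csub_mul x y) z.
Proof. by apply: val_inj; rewrite /= cmulA. Qed.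

Lemma csub_mulDl x y z : csub_mul (x + y) z = csub_mul x z + csub_mul y z.
Proof. by apply: val_inj; rewrite /= cmulDl. Qed.

Lemma csub_mulDr x y z : csub_mul x (y + z) = csub_mul x y + csub_mul x z.
Proof. by apply: val_inj; rewrite /= cmulDr. Qed.

Lemma csub_mulZl (a : R[i]) x y : csub_mul (a *: x) y = a *: csub_mul x y.
Proof. by apply: val_inj; rewrite /= cmulZl. Qed.

Lemma csub_mulZr (a : R[i]) x y : csub_mul x (a *: y) = a *: csub_mul x y.
Proof. by apply: val_inj; rewrite /= cmulZr. Qed.

Lemma csub_starK x : csub_starf (csub_starf x) = x.
Proof. by apply: val_inj; rewrite /= starK. Qed.

Lemma csub_starD x y : csub_starf (x + y) = csub_starf x + csub_starf y.
Proof. by apply: val_inj; rewrite /= starD. Qed.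

Lemma csub_starZ (a : R[i]) x : csub_starf (a *: x) = conjc a *: csub_starf x.
Proof. by apply: val_inj; rewrite /= starZ. Qed.

Lemma csub_starM x y :
  csub_starf (csub_mul x y) = csub_mul (csub_starf y) (csub_starf x).
Proof. by apply: val_inj; rewrite /= starM. Qed.

Lemma csub_normM (x y : T) : `|csub_mul x y| <= `|x| * `|y|.
Proof. exact: cnormM. Qed.

Lemma csub_norm_star (x : T) : `|csub_mul (csub_starf x) x| = `|x| ^+ 2.
Proof. exact: cnorm_star. Qed.

HB.instance Definition _ := isCStarAlgebra.Build R T
  csub_mulA csub_mulDl csub_mulDr csub_mulZl csub_mulZr csub_starK csub_starD
  csub_starZ csub_starM csub_normM csub_norm_star.

End Subalgebra.

Definition csub_alg (R : realType) (B : cstarAlgType R) (S : cstarSubalg B) :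
  cstarAlgType R := csub_type S.

(** The sequence is increasing for the order of [B], which agrees with that of
    [S] on the elements of [S]. *)
Definition monotone_sigma_closed (R : realType) (B : cstarAlgType R)
    (S : cstarSubalg B) :=
  forall (u : nat -> B) (s : B),
    (forall n, (S : set B) (u n)) -> bounded_increasing_sa u -> is_csup u s ->
    (S : set B) s.

(* Main.v *)
(* Calculus in a commutative C*-algebra is carried out in its unitization with
   squares of self-adjoint elements as positive elements: square roots come from
   the iteration r := (m + r^2) / 2, absolute values, positive parts and
   truncations at a constant from square roots. Every *-morphism between
   commutative C*-algebras preserves squares, and hence maps the positive part
   of m to the image of m as soon as that image is positive.

   Consequently an element of phi(A) lifts with control of the norm (so phi(A)
   is closed), and a positive one lifts to a positive one. An increasing
   sequence of phi(A) bounded by c then lifts to a bounded increasing sequence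
   of A: lift the increments to positive elements, add them up and truncate at
   c. Its supremum in A is mapped by phi to the supremum in B.

   Positivity in B is spectral. It is brought back to squares in a commutative
   subalgebra by showing, without the spectral radius formula, that l - g is
   not bounded below when g is the negative part of y and l = |g| > 0: with
   p = g / l one has N p^N (1 - p) <= 1 while |p^N| = 1. *)

Require Import Defs.
From HB Require Import structures.
From mathcomp Require Import all_boot all_order all_algebra.
From mathcomp Require Import all_classical all_reals all_analysis.
From mathcomp Require Import complex ring lra.

Set Implicit Arguments.
Unset Strict Implicit.
Unset Printing Implicit Defensive.

Import Order.TTheory GRing.Theory Num.Theory.
Import numFieldNormedType.Exports.

Local Open Scope classical_set_scope.
Local Open Scope ring_scope.
Local Open Scope complex_scope.

(** * Real-valued norms and completeness *)

Section RealNorm.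
Context {R : realType}.

(** The norm takes values in [R[i]]. Its real part is used so that all estimates live in the ordered
    field [R], within reach of [lra]. *)
Definition cabs (z : R[i]) : R := complex.Re `|z|.

Lemma cabsE z : (cabs z)%:C = `|z|.
Proof. by rewrite /cabs RRe_real// ger0_real. Qed.

Lemma cabs_ge0 z : 0 <= cabs z.
Proof. by rewrite -ler0c cabsE. Qed.

Lemma cabsD z w : cabs (z + w) <= cabs z + cabs w.
Proof. by rewrite -lecR rmorphD/= !cabsE ler_normD. Qed.

Lemma cabsM z w : cabs (z * w) = cabs z * cabs w.
Proof. by apply: complexI; rewrite rmorphM/= !cabsE normrM. Qed.

Lemma cabs_conj z : cabs z^* = cabs z.
Proof. by rewrite /cabs normcJ. Qed.

Lemma cabs_real (t : R) : cabs t%:C = `|t|.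
Proof. by rewrite /cabs normc_def /= expr0n /= addr0 sqrtr_sqr. Qed.

Lemma cabs_i : cabs 'i = 1.
Proof. by rewrite /cabs normc_def /= expr0n /= expr1n add0r sqrtr1. Qed.

Lemma cabs0 : cabs 0 = 0.
Proof. by rewrite /cabs normr0. Qed.

Lemma cabs_eq0 z : cabs z <= 0 -> z = 0.
Proof.
move=> h; have h0 : cabs z = 0 by apply/eqP; rewrite eq_le h cabs_ge0.
by apply/normr0_eq0; rewrite -cabsE h0.
Qed.

Section Mod.
Context {V : normedModType R[i]}.
Implicit Types x y : V.

Definition rnorm x : R := complex.Re `|x|.

Lemma rnormE x : (rnorm x)%:C = `|x|.
Proof. by rewrite /rnorm RRe_real// ger0_real. Qed.

Lemma rnorm_ge0 x : 0 <= rnorm x.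
Proof. by rewrite -ler0c rnormE. Qed.

Lemma rnormD x y : rnorm (x + y) <= rnorm x + rnorm y.
Proof. by rewrite -lecR rmorphD/= !rnormE ler_normD. Qed.

Lemma rnormZ a x : rnorm (a *: x) = cabs a * rnorm x.
Proof. by apply: complexI; rewrite rmorphM/= !rnormE cabsE normrZ. Qed.

Lemma rnormN x : rnorm (- x) = rnorm x.
Proof. by rewrite /rnorm normrN. Qed.

Lemma rnorm0 : rnorm (0 : V) = 0.
Proof. by rewrite /rnorm normr0. Qed.

Lemma rnormBC x y : rnorm (x - y) = rnorm (y - x).
Proof. by rewrite -opprB rnormN. Qed.

Lemma rnorm_eq0 x : rnorm x <= 0 -> x = 0.
Proof.
move=> h; have h0 : rnorm x = 0 by apply/eqP; rewrite eq_le h rnorm_ge0.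
by apply/normr0_eq0; rewrite -rnormE h0.
Qed.

End Mod.

Definition tends0 (e : nat -> R) :=
  forall d, 0 < d -> exists N, forall n, (N <= n)%N -> e n < d.

(** Completeness with a rate: the limit inherits the explicit error bound, which later estimates
    reuse. *)
Lemma rnorm_complete {V : completeNormedModType R[i]} (u : nat -> V)
    (e : nat -> R) :
  tends0 e -> (forall n k, rnorm (u (n + k)%N - u n) <= e n) ->
  exists l, forall n, rnorm (u n - l) <= e n.
Proof.
move=> e0 ue.
have uc : cauchy (u @ \oo).
  apply/cauchy_ballP => d d0.
  have dR : d = (complex.Re d)%:C by rewrite RRe_real// gtr0_real.
  have d1 : 0 < complex.Re d by rewrite -ltcR -dR.
  have d2 : 0 < complex.Re d / 2 by rewrite divr_gt0.
  have [N hN] := e0 _ d2.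
  rewrite near_simpl; near=> p => /=.
  have hb m : (N <= m)%N -> rnorm (u m - u N) < complex.Re d / 2.
    move=> Nm; rewrite -(subnKC Nm); apply: le_lt_trans (ue _ _) _; exact: hN.
  rewrite -ball_normE /ball_ /= -rnormE dR ltcR.
  have -> : u p.1 - u p.2 = (u p.1 - u N) + (u N - u p.2).
    by rewrite addrA subrK.
  apply: le_lt_trans (rnormD _ _) _.
  rewrite [ltRHS](splitr (complex.Re d)) ltrD//; last rewrite rnormBC.
    by apply: hb; near: p; exists ([set n | (N <= n)%N], setT) => /= [|[x y] []//]; split; [exists N|exact: filterT].
  by apply: hb; near: p; exists (setT, [set n | (N <= n)%N]) => /= [|[x y] []//]; split; [exact: filterT|exists N].
have /cvg_ex[l ul] : cvg (u @ \oo) by exact: cauchy_cvg.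
exists l => n.
apply/ler_addgt0Pr => d d0.
move/cvgrPdist_lt : ul => /(_ d%:C); rewrite ltcR => /(_ d0) [N _ hN].
have /= := hN (n + N)%N; rewrite /= leq_addl => /(_ isT).
rewrite -rnormE ltcR => hl.
have -> : u n - l = (u n - u (n + N)%N) + (u (n + N)%N - l).
  by rewrite addrA subrK.
apply: le_trans (rnormD _ _) _; apply: lerD; first by rewrite rnormBC.
by rewrite rnormBC ltW.
Unshelve. all: by end_near. Qed.

End RealNorm.

(** * Identities in commutative rings *)

Section Identities.
Context {V : comNzRingType}.
Implicit Types (a b d e f g h i l m n p q r s u x y : V).

(** Here [h] plays the role of one half, and below [i] that of the imaginary unit; both are given by
    their equations so that the identities apply in the unitization. *)
Lemma add_half h a : h + h = 1 -> h * (a + a) = a.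
Proof. by move=> h2; rewrite mulrDr -mulrDl h2 mul1r. Qed.

(** The defect of [r] as a solution of [(1 - r)^2 = 1 - m], in terms of its distances to two
    consecutive iterates [u] and [v]. *)
Lemma sqrt_iter_residue h m r u v : h + h = 1 -> v = h * (m + u ^+ 2) ->
  (1 - r) ^+ 2 - (1 - m) = (v - r) + (v - r) - (u - r) * (u + r).
Proof.
move=> h2 ->; set w := m + u ^+ 2.
have -> : h * w - r + (h * w - r) = h * (w + w) - (r + r) by ring.
by rewrite (add_half _ h2) /w; ring.
Qed.

Lemma mul_conj i x y : i * i = -1 -> (x - i * y) * (x + i * y) = x ^+ 2 + y ^+ 2.
Proof. by move=> i2; ring: i2. Qed.

Lemma conj_sqr_sum h i x s : h + h = 1 -> i * i = -1 -> s ^+ 2 = 1 - x ^+ 2 ->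
  1 - 2%:R * x ^+ 2 = h * (- (x + i * s) ^+ 2 - (x - i * s) ^+ 2).
Proof.
move=> h2 i2 s2; rewrite -[LHS](add_half _ h2); congr (_ * _).
have -> : - (x + i * s) ^+ 2 - (x - i * s) ^+ 2 =
  - 2%:R * (x ^+ 2 + (i * i) * s ^+ 2) by ring.
by rewrite i2 s2; ring.
Qed.

Lemma half_sqr h q m : h + h = 1 -> q ^+ 2 = m ^+ 2 ->
  (h * (q + m)) ^+ 2 = q * (h * (q + m)).
Proof.
move=> h2 qm; rewrite mulrCA -[q * _](add_half _ h2).
by have -> : q * (q + m) + q * (q + m) = (q + m) ^+ 2; [ring: qm|ring].
Qed.

Lemma half_sub h q m : h + h = 1 -> h * (q + m) - m = h * (q - m).
Proof. by move=> h2; rewrite -[X in _ - X](add_half _ h2); ring. Qed.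

Lemma half_mul_eq0 h q m : q ^+ 2 = m ^+ 2 -> h * (q + m) * (h * (q - m)) = 0.
Proof. by move=> qm; ring: qm. Qed.

Lemma abs_residue e f q : f ^+ 2 = q * f -> e ^+ 2 = f ^+ 2 ->
  (e - f) ^+ 2 * e + (e - f) ^+ 2 * q = 0.
Proof.
move=> fq ef; set d := e - f.
have h1 : d ^+ 2 = 2%:R * (d * e) by rewrite /d; ring: ef.
have h2 : d ^+ 2 = - (2%:R * (d * f)) by rewrite /d; ring: ef.
have h3 : d ^+ 2 * q = - (2%:R * (d * f ^+ 2)) by rewrite h2 fq; ring.
by rewrite h3 -ef h1; ring.
Qed.

Lemma npart_mul f g p n : p - n = f - g -> p * n = 0 -> n * g = n * f + n ^+ 2.
Proof.
move=> pn tt; have -> : g = f - (p - n) by rewrite pn; ring.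
by ring: tt.
Qed.

Lemma npart_cube a b f g p n : p - n = f - g ->
  n ^+ 2 * n + (n ^+ 2 * (a - b) + n ^+ 2 * (f - a)) =
  n * (p * n) + n ^+ 2 * (g - b).
Proof.
move=> pn; have -> : g = f - (p - n) by rewrite pn; ring.
by ring.
Qed.

(** With [a = p^n], the induction step showing that [1 - p^n - n p^n (1 - p)] is positive: the added
    term is positive. *)
Lemma pow_sub_step a p n :
  1 - p * a - (n + 1) * (p * a * (1 - p)) =
  (1 - a - n * (a * (1 - p))) + (n + 1) * (a * (1 - p) ^+ 2).
Proof. ring. Qed.

(** For [y = f - g] and [p q] a power of [p], this makes [p q] an approximate eigenvector of [y] at
    [- l] once [p q (1 - p)] is small. *)
Lemma mul_sub_eigen f g p q l : f * p = 0 -> g = l * p ->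
  (f - g) * (p * q) + l * (p * q) = l * (p * q * (1 - p)).
Proof. by move=> fp ->; ring: fp. Qed.

Lemma re_im_sqr h i m n : h + h = 1 -> i * i = -1 ->
  (h * (m + n)) ^+ 2 + (h * (i * (n - m))) ^+ 2 = n * m.
Proof.
move=> h2 i2.
have -> : (h * (m + n)) ^+ 2 + (h * (i * (n - m))) ^+ 2 =
  h * (h * ((m + n) ^+ 2 + (i * i) * (n - m) ^+ 2)) by ring.
rewrite i2 -[RHS](add_half _ h2); congr (_ * _).
by rewrite -[RHS](add_half _ h2); congr (_ * _); ring.
Qed.

End Identities.

(** * The unitization of a commutative C*-algebra *)

Section CStarBasics.
Context {R : realType} {A : cstarAlgType R}.
Implicit Types x y : A.

Lemma cmul0x x : 0 ** x = 0.
Proof. by have := cmulZl 0 0 x; rewrite !scale0r. Qed.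

Lemma cmulx0 x : x ** 0 = 0.
Proof. by have := cmulZr 0 x 0; rewrite !scale0r. Qed.

Lemma cmulNx x y : - x ** y = - (x ** y).
Proof. by rewrite -scaleN1r cmulZl scaleN1r. Qed.

Lemma cmulxN x y : x ** - y = - (x ** y).
Proof. by rewrite -scaleN1r cmulZr scaleN1r. Qed.

Lemma star0 : star (0 : A) = 0.
Proof. by have := starZ 0 (0 : A); rewrite conjc0 !scale0r. Qed.

Lemma starN x : star (- x) = - star x.
Proof. by rewrite -scaleN1r starZ rmorphN1 scaleN1r. Qed.

Lemma rnormM x y : rnorm (x ** y) <= rnorm x * rnorm y.
Proof. by rewrite -lecR rmorphM/= !rnormE cnormM. Qed.

Lemma rnorm_starM x : rnorm (star x ** x) = rnorm x ^+ 2.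
Proof. by apply: complexI; rewrite rmorphXn/= !rnormE cnorm_star. Qed.

Lemma rnorm_star x : rnorm (star x) = rnorm x.
Proof.
suff h (y : A) : rnorm y <= rnorm (star y).
  by apply/eqP; rewrite eq_le h andbT -[leRHS]/(rnorm x) -{2}(starK x) h.
have := rnormM (star y) y; rewrite rnorm_starM expr2.
have [->|y0] := eqVneq (rnorm y) 0; first by rewrite rnorm_ge0.
by rewrite ler_pM2r// lt_neqAle eq_sym y0 rnorm_ge0.
Qed.

Definition ustar (m : unitization A) : unitization A := (star m.1, m.2^*).

End CStarBasics.

(** The proof [hA] is a parameter of the type, so that a commutative ring structure can be attached
    and [ring] used, while [unitization] stays general. *)
Definition cunit (R : realType) (A : cstarAlgType R)
  (hA : cstar_commutative A) : Type := unitization A.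

Section CommutativeUnitization.
Context {R : realType} {A : cstarAlgType R} {hA : cstar_commutative A}.
Local Notation U := (cunit hA).

HB.instance Definition _ := GRing.NzRing.on U.

Lemma cunit_mulC : @commutative U U *%R.
Proof.
move=> [x a] [y b]; congr pair => /=; last exact: mulrC.
by rewrite hA addrAC.
Qed.

HB.instance Definition _ := GRing.PzRing_hasCommutativeMul.Build U cunit_mulC.

Definition cinj (x : A) : U := (x, 0).

Definition ccst (t : R) : U := (0, t%:C).

Definition ci : U := (0, 'i).

Definition cstar (m : U) : U := ustar m.

Lemma cinj_is_zmod_morphism : zmod_morphism cinj.
Proof. by move=> x y; congr pair; rewrite subr0. Qed.

HB.instance Definition _ := GRing.isZmodMorphism.Build A U cinj cinj_is_zmod_morphism.

Lemma ccst_is_zmod_morphism : zmod_morphism ccst.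
Proof. by move=> x y; congr pair; rewrite ?subr0// rmorphB. Qed.

Lemma ccst_is_monoid_morphism : monoid_morphism ccst.
Proof.
split=> // x y; congr pair; last by rewrite rmorphM.
by rewrite /= cmulx0 !scaler0 !addr0.
Qed.

HB.instance Definition _ := GRing.isZmodMorphism.Build R U ccst ccst_is_zmod_morphism.
HB.instance Definition _ :=
  GRing.isMonoidMorphism.Build R U ccst ccst_is_monoid_morphism.

Lemma cstar_is_zmod_morphism : zmod_morphism cstar.
Proof.
by move=> [x a] [y b]; congr pair; rewrite /= ?rmorphB// starD starN.
Qed.

Lemma cstar_is_monoid_morphism : monoid_morphism cstar.
Proof.
split=> [|[x a] [y b]]; congr pair; rewrite /= ?star0 ?oppr0 ?rmorphM//.
by rewrite !starD !starZ starM hA.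
Qed.

HB.instance Definition _ := GRing.isZmodMorphism.Build U U cstar cstar_is_zmod_morphism.
HB.instance Definition _ :=
  GRing.isMonoidMorphism.Build U U cstar cstar_is_monoid_morphism.

Lemma cunit_eq (m n : U) : m.1 = n.1 -> m.2 = n.2 -> m = n.
Proof. by case: m n => [x a] [y b] /= -> ->. Qed.

Lemma cstarK (m : U) : cstar (cstar m) = m.
Proof. by case: m => x a; congr pair; rewrite /= ?starK ?conjcK. Qed.

Lemma cstar_cst t : cstar (ccst t) = ccst t.
Proof. by apply: cunit_eq; rewrite /= ?star0 ?oppr0. Qed.

Lemma cstar_ci : cstar ci = - ci.
Proof. by apply: cunit_eq; rewrite /= ?star0 ?oppr0 // [RHS]/GRing.opp /= oppr0. Qed.

Lemma ci2 : ci * ci = -1.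
Proof.
apply: cunit_eq => /=; first by rewrite cmulx0 !scaler0 !addr0 oppr0.
by rewrite -expr2 sqr_i.
Qed.

Lemma cstar_inj x : cstar (cinj x) = cinj (star x).
Proof. by apply: cunit_eq; rewrite /= ?oppr0. Qed.

Lemma cinjM x y : cinj (x ** y) = cinj x * cinj y.
Proof. by apply: cunit_eq; rewrite /= ?mulr0// !scale0r !addr0. Qed.

Lemma cinj_inj : injective cinj.
Proof. by move=> x y []. Qed.

Lemma cinj1 (m : U) : m.2 = 0 -> cinj m.1 = m.
Proof. by case: m => x a /= ->. Qed.

End CommutativeUnitization.

Arguments cinj {R A} hA x.
Arguments ccst {R A} hA t.
Arguments ci {R A} hA.
Arguments cstar : simpl never.

(** * The C*-norm of the unitization *)

(** The intervals of centre [u k] and radius [e k] meet pairwise, so the supremum of their left ends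
    lies in all of them. *)
Lemma real_complete {R : realType} (u e : nat -> R) :
  (forall k j, `|u (k + j)%N - u k| <= e k) ->
  exists l, forall k, `|u k - l| <= e k.
Proof.
move=> ue.
have e0 k : 0 <= e k by apply: le_trans (ue k 0%N); exact: normr_ge0.
have lu k j : u k - e k <= u j + e j.
  have := e0 k; have := e0 j; case: (leqP k j) => [/subnKC <-|/ltnW/subnKC <-].
    by have := ue k (j - k)%N; rewrite ler_norml => /andP[? ?]; lra.
  by have := ue j (k - j)%N; rewrite ler_norml => /andP[? ?]; lra.
pose S := range (fun k => u k - e k).
have supS : has_sup S.
  split; first by exists (u 0%N - e 0%N); exists 0%N.
  by exists (u 0%N + e 0%N) => _ [k _ <-].
exists (sup S) => k; rewrite ler_norml.
have h1 : u k - e k <= sup S by apply: ub_le_sup; [case: supS|exists k].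
have h2 : sup S <= u k + e k.
  by apply: ge_sup; [case: supS|move=> _ [j _ <-]].
by apply/andP; split; lra.
Qed.

Lemma cabs_le_ReIm {R : realType} (z : R[i]) :
  cabs z <= `|complex.Re z| + `|complex.Im z|.
Proof.
rewrite {1}(complexE z); apply: le_trans (cabsD _ _) _.
by rewrite cabsM !cabs_real cabs_i mul1r.
Qed.

Lemma Re_Im_le_cabs {R : realType} (z : R[i]) :
  `|complex.Re z| <= cabs z /\ `|complex.Im z| <= cabs z.
Proof.
rewrite /cabs normc_def /= -!sqrtr_sqr.
by split; apply: ler_wsqrtr; rewrite ?lerDl ?lerDr sqr_ge0.
Qed.

Lemma ReB {R : realType} (z w : R[i]) :
  complex.Re (z - w) = complex.Re z - complex.Re w.
Proof. by case: z w => [a b] [c d]. Qed.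

Lemma ImB {R : realType} (z w : R[i]) :
  complex.Im (z - w) = complex.Im z - complex.Im w.
Proof. by case: z w => [a b] [c d]. Qed.

Lemma complex_complete {R : realType} (u : nat -> R[i]) (e : nat -> R) :
  (forall k j, cabs (u (k + j)%N - u k) <= e k) ->
  exists l, forall k, cabs (u k - l) <= e k + e k.
Proof.
move=> ue.
have [k j|a ha] := @real_complete _ (fun k => complex.Re (u k)) e.
  by rewrite -ReB; apply: le_trans (ue k j); have [] := Re_Im_le_cabs (u (k + j)%N - u k).
have [k j|b hb] := @real_complete _ (fun k => complex.Im (u k)) e.
  by rewrite -ImB; apply: le_trans (ue k j); have [] := Re_Im_le_cabs (u (k + j)%N - u k).
exists (a +i* b)%C => k; apply: le_trans (cabs_le_ReIm _) _.
by rewrite ReB ImB; exact: lerD.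
Qed.

Section Seminorm.
Context {R : realType} {A : cstarAlgType R} {hA : cstar_commutative A}.
Local Notation U := (cunit hA).
Implicit Types (m n : U) (x : A) (c d : R).

(* [ule m c] says that the C*-norm of [m] in the direct sum of the multiplier
   action on [A] and of the character [m.2] is at most [c]. *)
Definition ule m c :=
  [/\ 0 <= c, cabs m.2 <= c & forall x, rnorm (m * cinj hA x).1 <= c * rnorm x].

Lemma mul_cinj1 m x : cinj hA (m * cinj hA x).1 = m * cinj hA x.
Proof. by apply: cinj1; rewrite /= mulr0. Qed.

Lemma ule_ge0 m c : ule m c -> 0 <= c.
Proof. by case. Qed.

Lemma ule_weaken m c d : c <= d -> ule m c -> ule m d.
Proof.
move=> cd [c0 m2 hm]; split=> [||x]; [exact: le_trans cd|exact: le_trans cd|].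
by apply: le_trans (hm x) _; rewrite ler_wpM2r// rnorm_ge0.
Qed.

Lemma uleD m n c d : ule m c -> ule n d -> ule (m + n) (c + d).
Proof.
move=> [c0 m2 hm] [d0 n2 hn]; split=> [||x]; first exact: addr_ge0.
  by apply: le_trans (cabsD _ _) _; exact: lerD.
rewrite mulrDl mulrDl; apply: le_trans (rnormD _ _) _.
exact: lerD.
Qed.

Lemma uleM m n c d : ule m c -> ule n d -> ule (m * n) (c * d).
Proof.
move=> [c0 m2 hm] [d0 n2 hn]; split=> [||x]; first exact: mulr_ge0.
  by rewrite cabsM ler_pM// cabs_ge0.
rewrite -mulrA -mul_cinj1; apply: le_trans (hm _) _.
by rewrite -mulrA ler_wpM2l.
Qed.

Lemma ule_cst t : ule (ccst hA t) `|t|.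
Proof.
split=> [||x]; rewrite ?normr_ge0//= ?cabs_real//.
by rewrite cmul0x scaler0 !add0r rnormZ cabs_real.
Qed.

Lemma uleZ m c t : ule m c -> ule (ccst hA t * m) (`|t| * c).
Proof. by move=> hm; apply: uleM => //; exact: ule_cst. Qed.

Lemma uleN m c : ule m c -> ule (- m) c.
Proof.
move=> hm; have := uleZ (-1) hm.
by rewrite normrN1 mul1r rmorphN1 mulN1r.
Qed.

Lemma uleB m n c d : ule m c -> ule n d -> ule (m - n) (c + d).
Proof. by move=> hm hn; apply: uleD => //; exact: uleN. Qed.

Lemma ule1 : ule 1 1.
Proof. by have := ule_cst 1; rewrite rmorph1 normr1. Qed.

Lemma uleX m c k : ule m c -> ule (m ^+ k) (c ^+ k).
Proof.
move=> hm; elim: k => [|k ih]; first exact: ule1.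
by rewrite !exprS; exact: uleM.
Qed.

(** For [y = m x], commutativity turns [y^* y] into [(m^* m x) x^*], of norm at most [c^2 |x|^2];
    the C*-identity of [A] then bounds [|y|]. *)
Lemma ule_cstar_sqr m c : 0 <= c -> ule (cstar m * m) (c ^+ 2) -> ule m c.
Proof.
move=> c0 [_ m2 hm]; split=> // [|x].
  rewrite -ler_sqr ?nnegrE ?cabs_ge0//; apply: le_trans m2.
  by rewrite cabsM cabs_conj expr2.
rewrite -ler_sqr ?nnegrE ?rnorm_ge0 ?mulr_ge0 ?rnorm_ge0//.
rewrite -rnorm_starM.
set y := (m * cinj hA x).1.
have -> : star y ** y = (cstar m * m * cinj hA x).1 ** star x.
  apply: (@cinj_inj _ _ hA); rewrite !cinjM !mul_cinj1 -!cstar_inj mul_cinj1.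
  ring.
apply: le_trans (rnormM _ _) _; rewrite rnorm_star exprMn !expr2 mulrA.
by rewrite ler_wpM2r ?rnorm_ge0// -expr2.
Qed.

Lemma ule_cstar m c : ule m c -> ule (cstar m) c.
Proof.
move=> [c0 m2 hm]; split=> // [|x]; first by rewrite cabs_conj.
set y := (cstar m * cinj hA x).1.
have [->|y0] := eqVneq (rnorm y) 0; first by rewrite mulr_ge0 ?rnorm_ge0.
have y1 : 0 < rnorm y by rewrite lt_neqAle eq_sym y0 rnorm_ge0.
rewrite -(ler_pM2r y1) -expr2 -rnorm_starM.
have -> : star y ** y = (m * cinj hA y).1 ** star x.
  apply: (@cinj_inj _ _ hA).
  rewrite !cinjM !mul_cinj1 -!cstar_inj mul_cinj1.
  have -> : cstar (cstar m * cinj hA x) = cstar (cstar m) * cstar (cinj hA x).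
    by rewrite rmorphM.
  by rewrite cstarK; ring.
apply: le_trans (rnormM _ _) _; rewrite rnorm_star mulrAC.
by rewrite ler_wpM2r ?rnorm_ge0.
Qed.

Lemma ule_inj x : ule (cinj hA x) (rnorm x).
Proof.
split=> [||y]; first exact: rnorm_ge0.
  by rewrite /= cabs0 rnorm_ge0.
by rewrite -cinjM rnormM.
Qed.

(** Testing the multiplier bound on [star x] gives [|x|^2 <= c |x|]. *)
Lemma rnorm_ule x c : ule (cinj hA x) c -> rnorm x <= c.
Proof.
move=> [c0 _ h]; have := h (star x).
have [->//|x0] := eqVneq (rnorm x) 0.
rewrite -cinjM /= rnorm_star -{1}(starK x) rnorm_starM rnorm_star expr2.
by rewrite ler_pM2r// lt_neqAle eq_sym x0 rnorm_ge0.
Qed.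

Lemma ule_ex m : exists2 c, 0 < c & ule m c.
Proof.
exists (rnorm m.1 + cabs m.2 + 1).
  by rewrite ltr_wpDl// addr_ge0 ?rnorm_ge0 ?cabs_ge0.
have h0 : 0 <= rnorm m.1 by exact: rnorm_ge0.
have h1 : 0 <= cabs m.2 by exact: cabs_ge0.
split=> [||x]; [by lra|by lra|].
rewrite /= scale0r addr0.
have h2 := rnorm_ge0 x.
have := rnormD (m.1 ** x) (m.2 *: x); have := rnormM m.1 x.
rewrite rnormZ; lra.
Qed.

(** The bound on the character [m.2] first puts [m] in [A]. The action on [A] alone would not do: it
    has a kernel when [A] has a unit. *)
Lemma ule_eq0 m : ule m 0 -> m = 0.
Proof.
move=> hm; have [_ m2 _] := hm.
have e : cinj hA m.1 = m by apply: cinj1; exact: cabs_eq0.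
by rewrite -e in hm *; rewrite (rnorm_eq0 (rnorm_ule hm)) raddf0.
Qed.

Lemma ule_lim m c (e : nat -> R) :
  tends0 e -> (forall k, ule m (c + e k)) -> ule m c.
Proof.
move=> e0 me.
have small d : 0 < d -> exists k, e k < d.
  by move=> /e0[N hN]; exists N; exact: hN.
split=> [||x].
- apply/ler_addgt0Pr => d /small[k hk].
  by have := ule_ge0 (me k); lra.
- apply/ler_addgt0Pr => d /small[k hk].
  by have [_ h _] := me k; apply: le_trans h _; rewrite lerD2l ltW.
- apply/ler_addgt0Pr => d d0.
  have x1 : 0 < rnorm x + 1 by rewrite ltr_wpDl// rnorm_ge0.
  have [k hk] := small (d / (rnorm x + 1)) (divr_gt0 d0 x1).
  have [ek _ /(_ x) h] := me k; apply: le_trans h _.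
  rewrite mulrDl lerD2l.
  have [ek0|ek0] := leP (e k) 0.
    by apply: le_trans (ltW d0); rewrite mulr_le0_ge0// rnorm_ge0.
  rewrite ltr_pdivlMr// mulrDr mulr1 in hk.
  by apply: ltW; lra.
Qed.

Lemma ule_lim0 m (e : nat -> R) :
  tends0 e -> (forall k, ule m (e k)) -> m = 0.
Proof.
move=> e0 me; apply: ule_eq0; apply: ule_lim e0 _ => k.
by rewrite add0r.
Qed.

Lemma ule_complete (u : nat -> U) (e : nat -> R) : tends0 e ->
  (forall k j, ule (u (k + j)%N - u k) (e k)) ->
  exists l, forall k, ule (u k - l) (e k).
Proof.
move=> e0 ue.
have [k j|z hz] := @complex_complete _ (fun k => (u k).2) e.
  by have [_ + _] := ue k j.
have e2 : tends0 (fun k => e k + e k).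
  move=> d d0; have [|N hN] := e0 (d / 2); first by rewrite divr_gt0.
  by exists N => n /hN; lra.
have cinj12 m : cinj hA m.1 = m - (0, m.2).
  by apply: cunit_eq; rewrite /= ?subr0 ?subrr.
have sc_ule (w : R[i]) : ule (0, w) (cabs w).
  split=> [||x]; rewrite ?cabs_ge0//=.
  by rewrite cmul0x scaler0 !add0r rnormZ.
have [k j|a ha] := @rnorm_complete _ A (fun k => (u k).1) _ e2.
  apply: rnorm_ule.
  rewrite -[_ - _]/((u (k + j)%N - u k).1) cinj12; apply: uleB => //.
  by have [_ h _] := ue k j; exact: ule_weaken h (sc_ule _).
exists (a, z) => k.
have hl j : ule (u j - (a, z)) (e j + e j + (e j + e j)).
  have -> : u j - (a, z) = cinj hA ((u j).1 - a) + (0, (u j).2 - z).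
    by apply: cunit_eq; rewrite /= ?addr0 ?add0r.
  apply: uleD; first exact: ule_weaken (ha j) (ule_inj _).
  exact: ule_weaken (hz j) (sc_ule _).
have e3 : tends0 (fun k => e k + e k + (e k + e k)).
  move=> d d0; have [|N hN] := e0 (d / 4); first by rewrite divr_gt0.
  by exists N => n /hN; lra.
have e3k : tends0 (fun j => e (k + j)%N + e (k + j)%N + (e (k + j)%N + e (k + j)%N)).
  by move=> d /e3[N hN]; exists N => n Nn; apply: hN; exact: leq_trans Nn (leq_addl _ _).
(* The componentwise limit is so far controlled only by [4 e]. Passing through [u (k + j)] and
   letting [j] grow restores the sharp bound [e k]. *)
apply: ule_lim e3k _ => j.
have -> : u k - (a, z) = - (u (k + j)%N - u k) + (u (k + j)%N - (a, z)).
  by ring.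
by apply: uleD => //; apply: uleN.
Qed.

End Seminorm.

(** * Square roots *)

Section Sqrt.
Context {R : realType}.

(** The scalar case [m = 1] of the square root iteration; it dominates the norms of the iterates and
    of their increments. *)
Fixpoint rho (k : nat) : R :=
  if k is j.+1 then (1 + rho j ^+ 2) / 2 else 0.

Lemma rho01 k : 0 <= rho k <= 1.
Proof.
elim: k => [|k /andP[h0 h1]] /=; first by rewrite lexx ler01.
have : rho k ^+ 2 <= 1 by rewrite expr_le1.
by have := sqr_ge0 (rho k) => ? ?; apply/andP; split; lra.
Qed.

(** The gap [s = 1 - rho k] evolves by [s - s^2 / 2], an increasing function on [[0, 1]], so the
    bound propagates by induction. *)
Lemma rho_rate k : 1 - rho k <= 2 / k.+2%:R.
Proof.
elim: k => [|k ih] /=; first by lra.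
have /andP[h0 h1] := rho01 k.
pose t : R := k.+2%:R; have t2 : 2 <= t by rewrite ler_nat.
have -> : k.+3%:R = t + 1 :> R by rewrite natr1.
rewrite -/t in ih.
have t0 : 0 < t by lra.
pose s := 1 - rho k; have -> : rho k = 1 - s by rewrite /s; lra.
have -> : 1 - (1 + (1 - s) ^+ 2) / 2 = s - s ^+ 2 / 2 by field.
rewrite -/s in ih; have s0 : 0 <= s by rewrite /s; lra.
have s1 : s <= 1 by rewrite /s; lra.
pose v := 2 / t; have v1 : v <= 1 by rewrite /v ler_pdivrMr; lra.
apply: (@le_trans _ _ (v - v ^+ 2 / 2)).
  have : 0 <= (v - s) * (2 - v - s) by rewrite mulr_ge0//; rewrite -/v in ih; lra.
  by lra.
have -> : v - v ^+ 2 / 2 = 2 * (t - 1) / t ^+ 2 by rewrite /v; field; lra.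
rewrite ler_pdivrMr ?exprn_gt0// mulrAC ler_pdivlMr; last by lra.
by nra.
Qed.

Lemma tends0_inv (c : R) : tends0 (fun k => c / k.+2%:R).
Proof.
move=> d d0; exists (Num.Def.truncn (`|c| / d)) => n hn.
rewrite ltr_pdivrMr// mulrC -ltr_pdivrMr//.
apply: (@le_lt_trans _ _ (`|c| / d)).
  by rewrite ler_pM2r ?invr_gt0// ler_norm.
apply: lt_le_trans (truncnS_gt _) _.
by rewrite ler_nat ltnS; apply: leq_trans hn _.
Qed.

Context {A : cstarAlgType R} {hA : cstar_commutative A}.
Local Notation U := (cunit hA).
Implicit Types (m n a b r : U) (x : A) (c d t : R).

Local Notation half := (ccst hA 2^-1).

Lemma half2 : half + half = 1.
Proof. by rewrite -rmorphD -(rmorph1 (ccst hA)); congr ccst; field. Qed.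

Fixpoint sqrt_iter m (k : nat) : U :=
  if k is j.+1 then half * (m + sqrt_iter m j ^+ 2) else 0.

Lemma ule_sqrt_iter m k : ule m 1 -> ule (sqrt_iter m k) (rho k).
Proof.
move=> m1; elim: k => [|k ih] /=.
  by have := ule_cst (hA := hA) 0; rewrite rmorph0 normr0.
have -> : (1 + rho k ^+ 2) / 2 = `|2^-1| * (1 + rho k ^+ 2).
  by rewrite ger0_norm ?invr_ge0// mulrC.
by apply: uleZ; apply: uleD => //; exact: uleX.
Qed.

Lemma ule_sqrt_iterB m k : ule m 1 ->
  ule (sqrt_iter m k.+1 - sqrt_iter m k) (rho k.+1 - rho k).
Proof.
move=> m1; elim: k => [|k ih].
  rewrite /= expr0n /= !addr0 !subr0 expr0n /= addr0 mul1r.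
  have := uleZ 2^-1 m1.
  by rewrite ger0_norm ?invr_ge0// mulr1.
have -> : sqrt_iter m k.+2 - sqrt_iter m k.+1 = half *
   ((sqrt_iter m k.+1 - sqrt_iter m k) * (sqrt_iter m k.+1 + sqrt_iter m k)).
  by rewrite /=; ring.
have -> : rho k.+2 - rho k.+1 = `|2^-1| * ((rho k.+1 - rho k) * (rho k.+1 + rho k)).
  by rewrite ger0_norm ?invr_ge0//=; field.
by apply: uleZ; apply: uleM => //; apply: uleD; exact: ule_sqrt_iter.
Qed.

(** The iterates are Cauchy at the rate of [rho]. Their limit [r] is [1 - sqrt (1 - m)], and it
    inherits self-adjointness and the norm bound. *)
Lemma cunit_sqrt m : cstar m = m -> ule m 1 ->
  exists r, [/\ cstar r = r, ule r 1 & (1 - r) ^+ 2 = 1 - m].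
Proof.
move=> sm m1; pose u := sqrt_iter m.
have rate k j : ule (u (k + j)%N - u k) (rho (k + j) - rho k).
  elim: j => [|j ih].
    rewrite addn0 !subrr; have := ule_cst (hA := hA) 0.
    by rewrite rmorph0 normr0.
  have -> : u (k + j.+1)%N - u k = (u (k + j).+1 - u (k + j)%N) + (u (k + j)%N - u k).
    by rewrite addnS; ring.
  have -> : rho (k + j.+1) - rho k = (rho (k + j).+1 - rho (k + j)%N) + (rho (k + j)%N - rho k).
    by rewrite addnS; ring.
  by apply: uleD => //; exact: ule_sqrt_iterB.
pose e k : R := 2 / k.+2%:R.
have [|k j|r hr] := @ule_complete _ _ hA u e; first exact: tends0_inv.
  apply: ule_weaken (rate k j); apply: le_trans (rho_rate k).
  by have /andP[_] := rho01 (k + j); lra.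
have su k : cstar (u k) = u k.
  elim: k => [|k ih]; first by rewrite rmorph0.
  have -> : u k.+1 = half * (m + u k ^+ 2) by [].
  by rewrite rmorphM rmorphD rmorphXn /= ih sm cstar_cst.
have sr : cstar r = r.
  apply/eqP; rewrite -subr_eq0; apply/eqP.
  apply: (@ule_lim0 _ _ _ _ (fun k => 4 / k.+2%:R)); first exact: tends0_inv.
  move=> k; have -> : cstar r - r = - cstar (u k - r) + (u k - r).
    by rewrite rmorphB /= su; ring.
  have -> : 4 / k.+2%:R = e k + e k by rewrite /e; ring.
  by apply: uleD => //; apply: uleN; exact: ule_cstar.
have r1 : ule r 1.
  have e0 : tends0 e by exact: tends0_inv.
  apply: ule_lim e0 _ => k.
  have -> : r = u k - (u k - r) by ring.
  apply: uleB => //; apply: ule_weaken (ule_sqrt_iter k m1).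
  by have /andP[] := rho01 k.
exists r; split=> //.
apply/eqP; rewrite -subr_eq0; apply/eqP.
(* The residue is at most [4 e k]: twice [e k.+1] for the new iterate, and [e k] times a sum of norm
   at most [2]. *)
apply: (@ule_lim0 _ _ _ _ (fun k => 8 / k.+2%:R)); first exact: tends0_inv.
move=> k.
rewrite (@sqrt_iter_residue _ half m r (u k) (u k.+1) half2 erefl).
have ek : e k.+1 <= e k.
  by rewrite /e ler_pM2l// lef_pV2 ?posrE// ler_nat.
apply: (@ule_weaken _ _ _ _ (e k.+1 + e k.+1 + e k * (1 + 1))).
  apply: (@le_trans _ _ (e k + e k + e k * (1 + 1))); first by lra.
  by rewrite /e le_eqVlt; apply/orP; left; apply/eqP; ring.
apply: uleB; first exact: uleD.
apply: uleM => //; apply: uleD => //.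
apply: ule_weaken (ule_sqrt_iter k m1).
by have /andP[] := rho01 k.
Qed.

End Sqrt.

(** * Positive and negative parts *)

Section Positive.
Context {R : realType} {A : cstarAlgType R} {hA : cstar_commutative A}.
Local Notation U := (cunit hA).
Local Notation half := (ccst hA 2^-1).
Implicit Types (m n a b d f h q : U) (x : A) (c t : R).

Definition upos a := exists2 k, cstar k = k & a = k ^+ 2.

Lemma upos_sa a : upos a -> cstar a = a.
Proof. by case=> k sk ->; rewrite rmorphXn /= sk. Qed.

Lemma upos_sqr a : cstar a = a -> upos (a ^+ 2).
Proof. by exists a. Qed.

Lemma upos_cst t : 0 <= t -> upos (ccst hA t).
Proof.
by exists (ccst hA (Num.sqrt t)); rewrite ?cstar_cst// -rmorphXn sqr_sqrtr.
Qed.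

Lemma uposM a b : upos a -> upos b -> upos (a * b).
Proof.
by move=> [k sk ->] [l sl ->]; exists (k * l); rewrite ?rmorphM /= ?sk ?sl ?exprMn.
Qed.

Lemma upos1 : upos 1.
Proof. by have := upos_cst ler01; rewrite rmorph1. Qed.

Lemma uposX a k : upos a -> upos (a ^+ k).
Proof.
move=> ha; elim: k => [|k ih]; first exact: upos1.
by rewrite exprS; exact: uposM.
Qed.

Lemma ccst_halfK a : half * (a + a) = a.
Proof. exact: add_half (@half2 _ _ hA). Qed.

Lemma ule_half m n c : ule m c -> ule n c -> ule (half * (m + n)) c.
Proof.
move=> hm hn; have := uleZ 2^-1 (uleD hm hn).
by rewrite ger0_norm ?invr_ge0// (_ : 2^-1 * (c + c) = c)//; field.
Qed.

(* [u = h + i sqrt (1 - h^2)] is unitary and [1 - 2h^2 = - Re (u^2)]. *)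
Lemma ule_1B2sqr h : cstar h = h -> ule h 1 -> ule (1 - 2%:R * h ^+ 2) 1.
Proof.
move=> sh h1.
have [||r [sr r1 r2]] := @cunit_sqrt _ _ hA (h ^+ 2).
- by rewrite rmorphXn /= sh.
- by have := uleX 2 h1; rewrite expr1n.
pose u := h + ci hA * (1 - r).
have su : cstar u = h - ci hA * (1 - r).
  by rewrite rmorphD rmorphM rmorphB rmorph1 /= sh sr cstar_ci mulNr.
have u1 : ule u 1.
  apply: ule_cstar_sqr => //; rewrite expr1n su.
  by rewrite (mul_conj _ _ ci2) r2 addrC subrK; exact: ule1.
rewrite (conj_sqr_sum (@half2 _ _ hA) ci2 r2) -su.
by apply: ule_half; apply: uleN; rewrite -(expr1n R 2); apply: uleX => //; exact: ule_cstar.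
Qed.

Lemma ule_1Bsqr h : cstar h = h -> ule h 1 -> ule (1 - h ^+ 2) 1.
Proof.
move=> sh h1; have -> : 1 - h ^+ 2 = half * (1 + (1 - 2%:R * h ^+ 2)).
  by rewrite -[LHS]ccst_halfK; congr (_ * _); ring.
by apply: ule_half; [exact: ule1|exact: ule_1B2sqr].
Qed.

Lemma upos_ule m : cstar m = m -> ule (1 - m) 1 -> upos m.
Proof.
move=> sm m1; have [||r [sr r1 r2]] := @cunit_sqrt _ _ hA (1 - m) => //.
  by rewrite rmorphB rmorph1 /= sm.
exists (1 - r); first by rewrite rmorphB rmorph1 /= sr.
by rewrite r2; ring.
Qed.

Lemma ccstV t a : t != 0 -> ccst hA t * (ccst hA t^-1 * a) = a.
Proof. by move=> t0; rewrite mulrA -rmorphM divff// rmorph1 mul1r. Qed.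

(** The element [t a] is the square of [sqrt t * k], whose norm is at most [1] for [t <= c^-2]. The
    factor [2] lets two such bounds be averaged for a sum. *)
Lemma upos_small a : upos a ->
  exists2 T, 0 < T & forall t, 0 < t <= T -> ule (1 - 2%:R * (ccst hA t * a)) 1.
Proof.
move=> [k sk ->]; have [c c0 kc] := ule_ex k.
exists (c ^- 2); first by rewrite invr_gt0 exprn_gt0.
move=> t /andP[t0 tT].
have -> : ccst hA t * k ^+ 2 = (ccst hA (Num.sqrt t) * k) ^+ 2.
  by rewrite exprMn -rmorphXn sqr_sqrtr ?ltW.
apply: ule_1B2sqr; first by rewrite rmorphM /= cstar_cst sk.
apply: ule_weaken (uleZ _ kc).
rewrite ger0_norm ?sqrtr_ge0// -ler_sqr ?nnegrE ?mulr_ge0 ?sqrtr_ge0 ?(ltW c0)//.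
rewrite exprMn sqr_sqrtr ?(ltW t0)// expr1n.
by rewrite -ler_pdivlMr ?exprn_gt0// mul1r.
Qed.

(** Averaging the bounds of [upos_small] gives [|1 - t (a + b)| <= 1] for small [t], so [t (a + b)]
    has a square root. *)
Lemma uposD a b : upos a -> upos b -> upos (a + b).
Proof.
move=> ha hb; have [S S0 hS] := upos_small ha; have [T T0 hT] := upos_small hb.
pose t := Num.min S T.
have t0 : 0 < t by rewrite lt_min S0.
have h : upos (ccst hA t * (a + b)).
  apply: upos_ule.
    by rewrite rmorphM rmorphD /= cstar_cst !upos_sa.
  have -> : 1 - ccst hA t * (a + b) =
     half * (1 - 2%:R * (ccst hA t * a) + (1 - 2%:R * (ccst hA t * b))).
    by rewrite -[LHS]ccst_halfK; congr (_ * _); ring.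
  apply: ule_half; [apply: hS|apply: hT].
    by rewrite t0 ge_min lexx.
  by rewrite t0 ge_min lexx orbT.
have -> : a + b = ccst hA t^-1 * (ccst hA t * (a + b)).
  by rewrite mulrA -rmorphM mulVf ?gt_eqF// rmorph1 mul1r.
by apply: uposM => //; apply: upos_cst; rewrite invr_ge0 ltW.
Qed.

(* If [a = k^2] and [b = l^2], then [v = k + i l] is normal with
   [v^* v = a + b], and [k] is its real part. *)
Lemma ule_upos a b c : upos a -> upos b -> ule (a + b) c -> ule a c.
Proof.
move=> [k sk ->] [l sl ->] h; have c0 := ule_ge0 h.
pose v := k + ci hA * l.
have sv : cstar v = k - ci hA * l.
  by rewrite rmorphD rmorphM /= sk sl cstar_ci mulNr.
have v1 : ule v (Num.sqrt c).
  apply: ule_cstar_sqr; first exact: sqrtr_ge0.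
  by rewrite sqr_sqrtr// sv (mul_conj _ _ ci2).
have -> : k = half * (v + cstar v) by rewrite -[LHS]ccst_halfK; congr (_ * _); rewrite sv /v; ring.
rewrite -(sqr_sqrtr c0); apply: uleX; apply: ule_half => //.
exact: ule_cstar.
Qed.

Lemma ule00 : ule (0 : U) 0.
Proof. by have := ule_cst (hA := hA) 0; rewrite rmorph0 normr0. Qed.

Lemma uposD_eq0 a b : upos a -> upos b -> a + b = 0 -> a = 0.
Proof.
move=> ha hb e; apply: ule_eq0; apply: ule_upos ha hb _.
by rewrite e; exact: ule00.
Qed.

Lemma sa_sqr_eq0 d : cstar d = d -> d ^+ 2 = 0 -> d = 0.
Proof.
move=> sd d2; apply: ule_eq0; apply: ule_cstar_sqr => //.
by rewrite sd -expr2 d2 expr0n /=; exact: ule00.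
Qed.

(** The decomposition [t^2 = h^2 + (t - h) (t + h)] has positive terms, so [h^2] is bounded by
    [t^2]. *)
Lemma ule_between h t : 0 <= t -> cstar h = h -> upos (ccst hA t - h) -> upos (ccst hA t + h) ->
  ule h t.
Proof.
move=> t0 sh h1 h2; apply: ule_cstar_sqr => //; rewrite sh -expr2.
apply: (ule_upos (b := (ccst hA t - h) * (ccst hA t + h))).
- exact: upos_sqr.
- exact: uposM.
have -> : h ^+ 2 + (ccst hA t - h) * (ccst hA t + h) = ccst hA (t ^+ 2) by ring.
by rewrite -[X in ule _ X]ger0_norm ?sqr_ge0//; exact: ule_cst.
Qed.

Lemma upos_cstB h t : cstar h = h -> ule h t -> upos (ccst hA t - h).
Proof.
move=> sh ht; have [t0|t0] := eqVneq t 0.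
  rewrite t0 in ht *; rewrite (ule_eq0 ht) subr0; exact: upos_cst.
have t1 : 0 < t by rewrite lt_neqAle eq_sym t0 (ule_ge0 ht).
rewrite -(ccstV (ccst hA t - h) t0); apply: uposM; first by apply: upos_cst; exact: ltW.
apply: upos_ule; first by rewrite rmorphM rmorphB /= !cstar_cst sh.
have -> : 1 - ccst hA t^-1 * (ccst hA t - h) = ccst hA t^-1 * h.
  rewrite mulrBr -rmorphM mulVf// rmorph1; ring.
have := uleZ t^-1 ht; rewrite ger0_norm ?invr_ge0 ?(ltW t1)//.
by rewrite mulVf.
Qed.

Lemma cunit_abs m : cstar m = m -> exists2 q, upos q & q ^+ 2 = m ^+ 2.
Proof.
move=> sm; have [c c0 mc] := ule_ex m.
pose h := ccst hA c^-1 * m.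
have sh : cstar h = h by rewrite rmorphM /= cstar_cst sm.
have h1 : ule h 1.
  have := uleZ c^-1 mc; rewrite ger0_norm ?invr_ge0 ?(ltW c0)//.
  by rewrite mulVf// gt_eqF.
have [||r [sr r1 r2]] := @cunit_sqrt _ _ hA (1 - h ^+ 2).
- by rewrite rmorphB rmorph1 rmorphXn /= sh.
- exact: ule_1Bsqr.
exists (ccst hA c * (1 - r)).
  apply: uposM; first by apply: upos_cst; exact: ltW.
  (* The root [1 - r] is positive, not merely self-adjoint, because [r] has norm at most [1]. *)
  apply: upos_ule; first by rewrite rmorphB rmorph1 /= sr.
  by rewrite opprB addrC subrK.
rewrite exprMn r2; have -> : 1 - (1 - h ^+ 2) = h ^+ 2 by ring.
by rewrite -exprMn /h ccstV// gt_eqF.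
Qed.

(* With [e = |f|] and [d = e - f], the relations [f^2 = q f = e^2] give
   [d^2 (q + e) = 0], a sum of two positive elements. *)
Lemma upos_abs_half q m : upos q -> cstar m = m -> q ^+ 2 = m ^+ 2 ->
  upos (half * (q + m)).
Proof.
move=> hq sm qm; have sq := upos_sa hq.
set f := half * (q + m).
have sf : cstar f = f by rewrite rmorphM rmorphD /= cstar_cst sq sm.
have [e he ef] := cunit_abs sf; have se := upos_sa he.
have fq : f ^+ 2 = q * f by exact: half_sqr (@half2 _ _ hA) qm.
pose d := e - f.
have sd : cstar d = d by rewrite rmorphB /= se sf.
have hd2 : upos (d ^+ 2) by exact: upos_sqr.
have sum0 : d ^+ 2 * e + d ^+ 2 * q = 0 by exact: abs_residue.
have d2e : d ^+ 2 * e = 0.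
  by apply: uposD_eq0 sum0; exact: uposM.
have d2f : d ^+ 2 * f = 0.
  apply: sa_sqr_eq0; first by rewrite rmorphM rmorphXn /= sd sf.
  by rewrite exprMn -ef -exprMn d2e expr0n.
have d3 : d ^+ 2 * d = 0 by rewrite {2}/d mulrBr d2e d2f subr0.
have d0 : d = 0.
  apply: sa_sqr_eq0 => //; apply: sa_sqr_eq0; first by rewrite rmorphXn /= sd.
  by rewrite expr2 {2}expr2 mulrA d3 mul0r.
by have -> : f = e by apply/esym/eqP; rewrite -subr_eq0 -/d d0.
Qed.

(** Self-adjointness is assumed under the existential so that [ppart] can be chosen as a total
    function. *)
Lemma ppart_ex m : exists f, cstar m = m ->
  [/\ upos f, upos (f - m) & f * (f - m) = 0].
Proof.
have [sm|nsm] := pselect (cstar m = m); last by exists 0.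
have [q hq qm] := cunit_abs sm.
exists (half * (q + m)) => _.
have e : half * (q + m) - m = half * (q - m) by exact: half_sub half2.
split; rewrite ?e.
- exact: upos_abs_half.
- by apply: upos_abs_half => //; rewrite ?rmorphN /= ?sm ?sqrrN.
- exact: half_mul_eq0.
Qed.

Definition ppart m : U := projT1 (cid (ppart_ex m)).

Lemma ppartP m : cstar m = m ->
  [/\ upos (ppart m), upos (ppart m - m) & ppart m * (ppart m - m) = 0].
Proof. exact: projT2 (cid (ppart_ex m)). Qed.

(* On the negative part [t-] of [t = f - f'], where [f < f'], one has
   [f' > 0], hence [f' - b = 0] and [b = f' > f >= a]. *)
Lemma parts_mono a b f f' :
  upos f -> upos (f - a) -> upos (f' - b) -> f' * (f' - b) = 0 ->
  upos (a - b) -> upos (f - f').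
Proof.
move=> hf hfa hfb f0 hab.
have sa : cstar a = a by rewrite -(subKr f a) rmorphB /= !upos_sa.
have sb : cstar b = b by rewrite -(subKr a b) rmorphB /= sa upos_sa.
have hf' : cstar f' = f' by rewrite -(subrK b f') rmorphD /= sb upos_sa.
pose t := f - f'.
have st : cstar t = t by rewrite rmorphB /= hf' upos_sa.
have [ht htm tt] := ppartP st; set p := ppart t in ht htm tt.
pose n := p - t; rewrite -/n in htm tt.
have hn2 : upos (n ^+ 2) by apply: upos_sqr; exact: upos_sa.
have pn : p - n = f - f' by rewrite /n subKr.
have e1 : n * f' = n * f + n ^+ 2 by exact: npart_mul tt.
have e2 : n ^+ 2 * (f' - b) = 0.
  apply: (uposD_eq0 (b := n * (f' - b) * f)).
  - exact: uposM.
  - by apply: uposM => //; exact: uposM.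
  - rewrite [n * (f' - b) * f]mulrAC addrC -mulrDl.
    by rewrite -e1 -mulrA f0 mulr0.
have n3 : n ^+ 2 * n = 0.
  apply: (uposD_eq0 (b := n ^+ 2 * (a - b) + n ^+ 2 * (f - a))).
  - exact: uposM.
  - by apply: uposD; exact: uposM.
  - by rewrite (npart_cube _ _ pn) tt e2 mulr0 addr0.
have n0 : n = 0.
  apply: sa_sqr_eq0; first exact: upos_sa.
  apply: sa_sqr_eq0; first exact: upos_sa.
  by rewrite expr2 {2}expr2 mulrA n3 mul0r.
by rewrite -/t; have -> : t = p by rewrite -[LHS](subrK p) -opprB -/n n0 oppr0 add0r.
Qed.

Lemma upos_snd a : upos a -> exists2 t, 0 <= t & a.2 = t%:C.
Proof.
move=> [[x z] sk ->].
have /= : (cstar ((x, z) : U)).2 = z by rewrite sk.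
case: z sk => s t _ [] /eqP; rewrite -subr_eq0 -opprD oppr_eq0 -mulr2n mulrn_eq0 /= => /eqP ->.
by exists (s ^+ 2); rewrite ?sqr_ge0//= expr2; simpc.
Qed.

(** The character turns the positive part into that of a real number. This is how positive parts and
    truncations of elements of [A] are seen to stay in [A]. *)
Lemma ppart_snd m t : cstar m = m -> m.2 = t%:C -> (ppart m).2 = (Num.max t 0)%:C.
Proof.
move=> sm mt; have [h1 h2 h3] := ppartP sm.
have [s s0 es] := upos_snd h1; have [r r0 er] := upos_snd h2.
have e1 : r = s - t.
  by apply: complexI; rewrite -er rmorphB /= -es -mt.
have : s * (s - t) = 0.
  apply: complexI; rewrite rmorphM /= -e1 -es -er.
  by rewrite -[RHS]/((0 : U).2) -h3.
move=> /eqP; rewrite mulf_eq0 es => /orP[/eqP s00|/eqP st]; congr (_%:C).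
  by rewrite s00 max_r//; lra.
by rewrite max_l; lra.
Qed.

End Positive.

(** * Inverses, truncation and morphisms *)

Section Inverse.
Context {R : realType} {A : cstarAlgType R} {hA : cstar_commutative A}.
Local Notation U := (cunit hA).
Implicit Types (m n a b d f h q : U) (x : A) (c t : R).

Lemma tends0_geo (C c : R) : 0 <= c < 1 -> tends0 (fun k => C * c ^+ k).
Proof.
move=> /andP[c0 c1] d d0.
have C1 : 0 < `|C| + 1 by rewrite ltr_wpDl.
have : (fun k => c ^+ k) @ \oo --> (0 : R) by apply: cvg_expr; rewrite ger0_norm.
move=> /cvgrPdist_lt /(_ (d / (`|C| + 1)) (divr_gt0 d0 C1)) [N _ hN].
exists N => k /hN /=; rewrite sub0r normrN ger0_norm ?exprn_ge0//.
rewrite ltr_pdivlMr// => h; apply: le_lt_trans h; rewrite mulrC ler_wpM2l ?exprn_ge0//.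
by have := ler_norm C; lra.
Qed.

Lemma neumann n c : ule n c -> c < 1 -> exists y, (1 - n) * y = 1.
Proof.
move=> hn c1; have c0 := ule_ge0 hn.
pose s k : U := \sum_(i < k) n ^+ i.
have sD k j : s (k + j)%N - s k = n ^+ k * s j.
  rewrite /s big_split_ord /= addrAC subrr add0r mulr_sumr.
  by apply: eq_bigr => i _; rewrite exprD.
have s1 k : (1 - n) * s k = 1 - n ^+ k.
  by rewrite /s -opprB mulNr -subrX1 opprB.
have us k : ule (s k) ((1 - c)^-1).
  have : ule (s k) (\sum_(i < k) c ^+ i).
    rewrite /s; elim: k => [|k ih]; first by rewrite !big_ord0; exact: ule00.
    by rewrite !big_ord_recr /=; apply: uleD => //; exact: uleX.
  apply: ule_weaken; have c2 : 0 < 1 - c by lra.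
  rewrite -(ler_pM2l c2) mulfV ?gt_eqF// -opprB mulNr -subrX1 opprB.
  by rewrite gerBl exprn_ge0.
have e0 : tends0 (fun k => (1 - c)^-1 * c ^+ k) by apply: tends0_geo; rewrite c0.
have [k j|y hy] := @ule_complete _ _ hA s _ e0.
  by rewrite sD mulrC; apply: uleM => //; exact: uleX.
exists y; apply/eqP; rewrite -subr_eq0; apply/eqP.
have e1 : tends0 (fun k => ((1 + c) * (1 - c)^-1 + 1) * c ^+ k).
  by apply: tends0_geo; rewrite c0.
apply: ule_lim0 e1 _ => k.
have -> : (1 - n) * y - 1 = - ((1 - n) * (s k - y)) - n ^+ k.
  by rewrite mulrBr s1; ring.
have -> : ((1 + c) * (1 - c)^-1 + 1) * c ^+ k = (1 + c) * ((1 - c)^-1 * c ^+ k) + c ^+ k.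
  by ring.
apply: uleB; last exact: uleX.
by apply: uleN; apply: uleM => //; apply: uleB => //; exact: ule1.
Qed.

(** Write [2 T (t + m) = (1 + 2 T t) - (1 - 2 T m)]. The last term has norm at most [1], so after
    scaling by [c] the Neumann series applies. *)
Lemma upos_inv m t : upos m -> 0 < t -> exists y, (ccst hA t + m) * y = 1.
Proof.
move=> hm t0; have [T T0 /(_ T)] := upos_small hm.
rewrite T0 lexx => /(_ isT) h.
have d0 : 0 < 1 + 2 * T * t by rewrite ltr_wpDr// !mulr_ge0// ltW.
pose c := (1 + 2 * T * t)^-1.
have c0 : 0 < c by rewrite invr_gt0.
have c1 : c < 1 by rewrite invf_lt1// ltrDl !mulr_gt0.
have hc : 1 - c = 2 * T * t * c.
  by rewrite /c; field; rewrite gt_eqF.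
have [||y hy] := @neumann (ccst hA c * (1 - 2%:R * (ccst hA T * m))) c => //.
  by have := uleZ c h; rewrite ger0_norm ?(ltW c0)// mulr1.
exists (2%:R * ccst hA T * ccst hA c * y).
have hc1 : (1 : U) = ccst hA c + 2%:R * ccst hA T * ccst hA t * ccst hA c.
  have -> : 2%:R = ccst hA 2 by rewrite rmorph_nat.
  by rewrite -!rmorphM -rmorphD -hc addrC subrK rmorph1.
rewrite -[RHS]hy [X in (X - _) * y]hc1; ring.
Qed.

Definition ccplx (z : R[i]) : U := (0, z).

Lemma ccplxE (z : R[i]) :
  ccplx z = ccst hA (complex.Re z) + ci hA * ccst hA (complex.Im z).
Proof.
apply: cunit_eq; rewrite /= ?cmulx0 ?scaler0 ?addr0//.
by rewrite -complexE.
Qed.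

(** Let [z = s + i w] not be a nonnegative real. If [w = 0], then [x - s] is positive plus a
    positive constant; otherwise [x - z] divides [(x - s)^2 + w^2], which is of that kind. *)
Lemma upos_cpositive x : upos (cinj hA x) -> cpositive x.
Proof.
move=> hx; have sx := upos_sa hx.
split; first by apply: (@cinj_inj _ _ hA); rewrite -cstar_inj.
move=> z; apply: contra_notP => nz.
suff [y hy] : exists y, (cinj hA x - ccplx z) * y = 1.
  exists y; have -> : uinj x - z *: (1 : unitization A) = cinj hA x - ccplx z.
    by apply: cunit_eq; rewrite /= ?scaler0// -[_ *: _]/(z * 1) mulr1.
  by split; [exact: hy|move: hy; rewrite mulrC].
rewrite ccplxE; move: nz; case: z => s w /=.
have [->|w0] := eqVneq w 0.
  move=> /negP; rewrite ler0c -ltNge -oppr_gt0 => s0.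
  have [y hy] := upos_inv hx s0.
  by exists y; rewrite -[RHS]hy rmorph0 rmorphN; ring.
move=> _.
have h : upos ((cinj hA x - ccst hA s) ^+ 2).
  by apply: upos_sqr; rewrite rmorphB /= sx cstar_cst.
have w2 : 0 < w ^+ 2 by rewrite exprn_even_gt0//= w0.
have [y hy] := upos_inv h w2.
exists ((cinj hA x - ccst hA s + ci hA * ccst hA w) * y).
rewrite -[RHS]hy mulrA; congr (_ * y).
by rewrite opprD addrA (mul_conj _ _ ci2) [RHS]addrC rmorphXn.
Qed.

(* [max (min (x, c), - c)], computed in the unitization. *)
Definition clipU c m : U :=
  ppart ((ccst hA c - ppart (ccst hA c - m)) + ccst hA c) - ccst hA c.

Definition clip c x : A := (clipU c (cinj hA x)).1.

Lemma ppart_sa m : cstar m = m -> cstar (ppart m) = ppart m.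
Proof. by move=> /ppartP[/upos_sa]. Qed.

Lemma clipU_sa c m : cstar m = m -> cstar (clipU c m) = clipU c m.
Proof.
move=> sm; have h : cstar (ccst hA c - m) = ccst hA c - m.
  by rewrite rmorphB /= cstar_cst sm.
rewrite rmorphB /= cstar_cst ppart_sa// rmorphD rmorphB /= !cstar_cst.
by rewrite ppart_sa.
Qed.

Lemma clipU_ule c m : 0 <= c -> cstar m = m -> ule (clipU c m) c.
Proof.
move=> c0 sm; have h : cstar (ccst hA c - m) = ccst hA c - m.
  by rewrite rmorphB /= cstar_cst sm.
have [h1 h2 h3] := ppartP h.
set y := ccst hA c - ppart (ccst hA c - m).
have sy : cstar (y + ccst hA c) = y + ccst hA c.
  by rewrite rmorphD rmorphB /= !cstar_cst ppart_sa.
have [k1 k2 k3] := ppartP sy.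
apply: ule_between => //; first exact: clipU_sa.
  have -> : ccst hA c - clipU c m = ccst hA (c + c) - ppart (y + ccst hA c).
    by rewrite /clipU -/y; ring.
  have c2 : upos (ccst hA (c + c)) by apply: upos_cst; exact: addr_ge0.
  (* The constant [c + c] serves as its own positive part, and [y + c <= c + c] because [y] is [c]
     minus a positive part. *)
  apply: (@parts_mono _ _ _ (ccst hA (c + c)) _ _ _ _ _ k2 k3) => //.
    by rewrite subrr -(rmorph0 (ccst hA)); exact: upos_cst.
  have -> : ccst hA (c + c) - (y + ccst hA c) = ppart (ccst hA c - m) => //.
  by rewrite /y; ring.
have -> : ccst hA c + clipU c m = ppart (y + ccst hA c) => //.
by rewrite /clipU -/y; ring.
Qed.

Lemma ppart_mono m n : cstar m = m -> cstar n = n -> upos (n - m) ->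
  upos (ppart n - ppart m).
Proof.
move=> sm sn mn; have [h1 h2 h3] := ppartP sm; have [k1 k2 k3] := ppartP sn.
exact: parts_mono k1 k2 h2 h3 mn.
Qed.

Lemma clipU_mono c m n : cstar m = m -> cstar n = n -> upos (n - m) ->
  upos (clipU c n - clipU c m).
Proof.
move=> sm sn mn.
have hs k : cstar k = k -> cstar (ccst hA c - k) = ccst hA c - k.
  by move=> sk; rewrite rmorphB /= cstar_cst sk.
have hs2 k : cstar k = k -> cstar (ccst hA c - ppart (ccst hA c - k) + ccst hA c) =
    ccst hA c - ppart (ccst hA c - k) + ccst hA c.
  by move=> /hs sk; rewrite rmorphD rmorphB /= cstar_cst ppart_sa.
have -> : clipU c n - clipU c m = ppart (ccst hA c - ppart (ccst hA c - n) + ccst hA c) -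
    ppart (ccst hA c - ppart (ccst hA c - m) + ccst hA c) by rewrite /clipU; ring.
apply: ppart_mono; [exact: hs2|exact: hs2|].
have -> : ccst hA c - ppart (ccst hA c - n) + ccst hA c -
   (ccst hA c - ppart (ccst hA c - m) + ccst hA c) =
   ppart (ccst hA c - m) - ppart (ccst hA c - n) by ring.
apply: ppart_mono; [exact: hs|exact: hs|].
by have -> : ccst hA c - m - (ccst hA c - n) = n - m by ring.
Qed.

(** At the character, where [x] vanishes, truncation fixes [0]; so the result, computed in the
    unitization, lies in [A]. *)
Lemma clipE c x : 0 <= c -> star x = x -> cinj hA (clip c x) = clipU c (cinj hA x).
Proof.
move=> c0 sx; apply: cinj1.
have sX : cstar (cinj hA x) = cinj hA x by rewrite cstar_inj sx.
have h : cstar (ccst hA c - cinj hA x) = ccst hA c - cinj hA x.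
  by rewrite rmorphB /= cstar_cst sX.
have e1 : (ppart (ccst hA c - cinj hA x)).2 = c%:C.
  rewrite (@ppart_snd _ _ _ _ c)//; last by rewrite /= subr0.
  by rewrite max_l.
have h2 : cstar (ccst hA c - ppart (ccst hA c - cinj hA x) + ccst hA c) =
    ccst hA c - ppart (ccst hA c - cinj hA x) + ccst hA c.
  by rewrite rmorphD rmorphB /= cstar_cst ppart_sa.
rewrite /clipU /= (@ppart_snd _ _ _ _ c)//; last by rewrite /= e1 subrr add0r.
by rewrite max_l// subrr.
Qed.

(** By commutativity [m] is normal, and [m^* m] is the sum of the squares of its real and imaginary
    parts. *)
Lemma cstarM_upos m : upos (cstar m * m).
Proof.
pose a := ccst hA 2^-1 * (m + cstar m).
pose b := ccst hA 2^-1 * (ci hA * (cstar m - m)).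
have sa : cstar a = a by rewrite /a rmorphM rmorphD /= cstar_cst cstarK addrC.
have sb : cstar b = b.
  rewrite /b !rmorphM rmorphB /= cstar_cst cstarK cstar_ci; ring.
rewrite -(re_im_sqr m (cstar m) (@half2 _ _ hA) ci2).
by apply: uposD; exact: upos_sqr.
Qed.

End Inverse.

Arguments clip {R A} hA c x.

(** * Morphisms between commutative algebras: norms, positive parts and truncations *)

Section Morphism.
Context {R : realType} {A D : cstarAlgType R}.
Context {hA : cstar_commutative A} {hD : cstar_commutative D}.
Context (psi : {linear A -> D}) (mpsi : star_morphism psi).
Implicit Types (m : cunit hA) (x : A).

Definition umap (m : cunit hA) : cunit hD := (psi m.1, m.2).

Lemma umapD m n : umap (m + n) = umap m + umap n.
Proof. by apply: cunit_eq; rewrite /= ?linearD. Qed.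

Lemma umapB m n : umap (m - n) = umap m - umap n.
Proof. by apply: cunit_eq; rewrite /= ?linearB. Qed.

Lemma umapM m n : umap (m * n) = umap m * umap n.
Proof.
by apply: cunit_eq; rewrite //= !linearD !linearZ /= (star_morphismM mpsi).
Qed.

Lemma umap_cstar m : umap (cstar m) = cstar (umap m).
Proof. by apply: cunit_eq; rewrite //= (star_morphism_star mpsi). Qed.

Lemma umap_cst t : umap (ccst hA t) = ccst hD t.
Proof. by apply: cunit_eq; rewrite //= linear0. Qed.

Lemma umap_inj x : umap (cinj hA x) = cinj hD (psi x).
Proof. by []. Qed.

Lemma umap_upos m : upos m -> upos (umap m).
Proof.
move=> [k sk ->]; exists (umap k); first by rewrite -umap_cstar sk.
by rewrite !expr2 umapM.
Qed.

(** The positive elements [m^* m] and [c^2 - m^* m] have positive images whose sum is still [c^2],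
    which bounds the first one. *)
Lemma umap_ule m c : ule m c -> ule (umap m) c.
Proof.
move=> mc; have c0 := ule_ge0 mc; apply: ule_cstar_sqr => //.
rewrite -umap_cstar -umapM.
have h : upos (cstar m * m) by exact: cstarM_upos.
have hm : ule (cstar m * m) (c ^+ 2).
  by rewrite expr2; apply: uleM => //; exact: ule_cstar.
apply: (ule_upos (b := umap (ccst hA (c ^+ 2) - cstar m * m))).
- exact: umap_upos.
- by apply: umap_upos; apply: upos_cstB hm; exact: upos_sa.
rewrite -umapD [X in umap X](_ : _ = ccst hA (c ^+ 2)); last by ring.
rewrite umap_cst -[X in ule _ X]ger0_norm ?sqr_ge0//; exact: ule_cst.
Qed.

Lemma rnorm_morph x : rnorm (psi x) <= rnorm x.
Proof.
apply: (@rnorm_ule _ _ hD); rewrite -umap_inj; apply: umap_ule.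
exact: ule_inj.
Qed.

(** For [g = ppart m - m], the relation [g^2 + g m = g (ppart m) = 0] passes to the images. There
    both terms are positive, so [g] maps to an element of square [0]. *)
Lemma umap_ppart m : cstar m = m -> upos (umap m) -> umap (ppart m) = umap m.
Proof.
move=> sm hm; have [h1 h2 h3] := ppartP sm.
set f := ppart m in h1 h2 h3 *; set g := f - m in h2 h3.
have hg : upos (umap g) by exact: umap_upos.
have g2 : umap g ^+ 2 = 0.
  apply: (uposD_eq0 (b := umap g * umap m)).
  - exact: uposX.
  - exact: uposM.
  - rewrite expr2 -mulrDr -umapD /g subrK -umapM mulrC h3.
    by rewrite -(rmorph0 (ccst hA)) umap_cst rmorph0.
have : umap g = 0 by apply: sa_sqr_eq0 => //; exact: upos_sa.
by rewrite /g umapB => /eqP; rewrite subr_eq0 => /eqP.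
Qed.

(** The image already lies between [- c] and [c], so by [umap_ppart] neither of the two positive
    parts changes it. *)
Lemma umap_clipU c m : cstar m = m -> ule (umap m) c ->
  umap (clipU c m) = umap m.
Proof.
move=> sm hm.
have su : cstar (umap m) = umap m by rewrite -umap_cstar sm.
have h1 : umap (ppart (ccst hA c - m)) = ccst hD c - umap m.
  rewrite umap_ppart ?umapB ?umap_cst//; last exact: upos_cstB.
  by rewrite rmorphB /= cstar_cst sm.
rewrite /clipU umapB umap_cst umap_ppart.
- by rewrite umapD umapB h1 umap_cst; ring.
- rewrite rmorphD rmorphB /= !cstar_cst ppart_sa//.
  by rewrite rmorphB /= cstar_cst sm.
- rewrite umapD umapB h1 umap_cst.
  have -> : ccst hD c - (ccst hD c - umap m) + ccst hD c = ccst hD c - (- umap m).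
    by ring.
  apply: upos_cstB; last exact: uleN.
  by rewrite rmorphN /= su.
Qed.

Lemma clip_lift c x : star x = x -> rnorm (psi x) <= c ->
  psi (clip hA c x) = psi x /\ rnorm (clip hA c x) <= c.
Proof.
move=> sx xc; have c0 : 0 <= c by apply: le_trans xc; exact: rnorm_ge0.
have sX : cstar (cinj hA x) = cinj hA x by rewrite cstar_inj sx.
split.
  apply: (@cinj_inj _ _ hD); rewrite -!umap_inj clipE//.
  by apply: umap_clipU => //; exact: ule_weaken xc (ule_inj _).
apply: (@rnorm_ule _ _ hA); rewrite clipE//.
exact: clipU_ule.
Qed.

End Morphism.

(** * Spectral positivity in a subalgebra *)

Section SpectralPermanence.
Context {R : realType}.

Lemma spectrum_morph (A D : cstarAlgType R) (psi : {linear A -> D}) (x : A) :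
  (forall y z, psi (y ** z) = psi y ** psi z) ->
  spectrum (psi x) `<=` spectrum x.
Proof.
move=> hM z; apply: contra_not => -[y [h1 h2]].
pose F (m : unitization A) : unitization D := (psi m.1, m.2).
have FM m n : F (m * n) = F m * F n.
  by congr pair; rewrite /= !linearD !linearZ /= hM.
have F1 : F 1 = 1 by congr pair; rewrite /= linear0.
have Fx : F (uinj x - z *: (1 : unitization A)) = uinj (psi x) - z *: (1 : unitization D).
  by congr pair; rewrite /= linearB linearZ /= linear0.
by exists (F y); rewrite /= -Fx -!FM h1 h2.
Qed.

Lemma cpositive_morph (A D : cstarAlgType R) (psi : {linear A -> D}) (x : A) :
  star_morphism psi -> cpositive x -> cpositive (psi x).
Proof.
move=> [hM hs] [sx px]; split; first by rewrite /selfadjoint -hs sx.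
by move=> z /(spectrum_morph hM); exact: px.
Qed.

Context {B : cstarAlgType R} (S : cstarSubalg B).
Context {hS : cstar_commutative (csub_alg S)}.
Local Notation D := (csub_alg S).

Lemma rnorm_val (x : D) : rnorm x = rnorm (csub_val x : B).
Proof. by []. Qed.

(** The C*-identity carries the lower bound [1] along repeated squaring to [p^(2^n)]; as [n <= 2^n]
    and [p] has norm at most [1], it holds for [p^n]. *)
Lemma ule_pow_ge1 (p : cunit hS) (c : R) : cstar p = p -> ule p 1 ->
  (forall d, ule p d -> 1 <= d) -> forall n, ule (p ^+ n) c -> 1 <= c.
Proof.
move=> sp p1 hp n pn.
suff h k d : ule (p ^+ (2 ^ k)) d -> 1 <= d.
  apply: (h n); have -> : (2 ^ n = n + (2 ^ n - n))%N by rewrite subnKC// ltnW// ltn_expl.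
  rewrite exprD -[c]mulr1; apply: uleM => //.
  by rewrite -(expr1n R (2 ^ n - n)); exact: uleX.
elim: k d => [|k ih] d; first by rewrite expn0 expr1; exact: hp.
move=> h; have d0 := ule_ge0 h.
have /ih : ule (p ^+ (2 ^ k)) (Num.sqrt d).
  apply: ule_cstar_sqr; first exact: sqrtr_ge0.
  by rewrite sqr_sqrtr// rmorphXn /= sp -expr2 -exprM -expnSr.
by rewrite -{2}(sqr_sqrtr d0) => h1; rewrite exprn_ege1.
Qed.

(** Induction with [pow_sub_step] gives [n p^n (1 - p) <= 1 - p^n <= 1]. *)
Lemma ule_pow_sub (p : cunit hS) N : upos p -> ule p 1 ->
  ule (p ^+ N.+1 * (1 - p)) (N.+1%:R^-1).
Proof.
move=> hp p1; have sp := upos_sa hp.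
have hq : upos (1 - p).
  have := upos_cstB sp p1; by rewrite rmorph1.
have hT : forall n, upos (1 - p ^+ n - n%:R * (p ^+ n * (1 - p))).
  elim=> [|n ih].
    by rewrite expr0 subrr mul0r subr0 -(rmorph0 (ccst hS)); exact: upos_cst.
  rewrite exprS -natr1 pow_sub_step natr1.
  apply: uposD => //; apply: uposM; last by apply: uposM; apply: uposX.
  by rewrite -(rmorph_nat (ccst hS)); apply: upos_cst.
have N0 : N.+1%:R != 0 :> R by rewrite pnatr_eq0.
rewrite -[X in ule X _](ccstV _ N0).
rewrite [X in ule X _](_ : _ = ccst hS N.+1%:R^-1 * (N.+1%:R * (p ^+ N.+1 * (1 - p)))); last first.
  by rewrite rmorph_nat; ring.
rewrite -[X in ule _ X]mulr1 -{2}(@ger0_norm _ (N.+1%:R^-1)) ?invr_ge0//.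
apply: uleZ.
apply: (ule_upos (b := (1 - p ^+ N.+1 - N.+1%:R * (p ^+ N.+1 * (1 - p))) + p ^+ N.+1)).
- apply: uposM; last by apply: uposM => //; apply: uposX.
  by rewrite -(rmorph_nat (ccst hS)); apply: upos_cst.
- by apply: uposD => //; exact: uposX.
- by rewrite addrC addrAC !subrK; exact: ule1.
Qed.

(** The spectrum is taken in [B], whereas the square root is found in the commutative subalgebra
    [S]; this links the order of [B] to the calculus with squares. *)
Lemma cpositive_upos (y : D) : cpositive (csub_val y : B) -> upos (cinj hS y).
Proof.
move=> [sy py].
have sY : cstar (cinj hS y) = cinj hS y.
  by rewrite cstar_inj; congr cinj; apply: val_inj; exact: sy.
have [h1 h2 h3] := ppartP sY.
set f := ppart (cinj hS y) in h1 h2 h3; set g := f - cinj hS y in h2 h3.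
have g20 : g.2 = 0.
  by rewrite /g /f /= (@ppart_snd _ _ _ _ 0)// maxxx subr0.
have gE : cinj hS g.1 = g by exact: cinj1.
have [g0|g0] := leP (rnorm g.1) 0.
  have : g = 0 by rewrite -gE (rnorm_eq0 g0) raddf0.
  by rewrite /g => /eqP; rewrite subr_eq0 => /eqP <-.
exfalso.
set l := rnorm g.1 in g0.
(* As [- l < 0] is outside the spectrum, [y + l] is invertible over [B]. *)
have [r [_ hr]] : exists r : unitization B,
    let x := uinj (csub_val y) - (- l)%:C *: (1 : unitization B) in
    x * r = 1 /\ r * x = 1.
  apply: contrapT => /py; rewrite ler0c; lra.
pose C := rnorm r.1 + cabs r.2.
pose p := ccst hS l^-1 * g.
have hp : upos p by apply: uposM => //; apply: upos_cst; rewrite invr_ge0 ltW.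
have gl : g = ccst hS l * p by rewrite ccstV// gt_eqF.
have p1 : ule p 1.
  have : ule g l by rewrite -gE; exact: ule_inj.
  by move=> /(uleZ l^-1); rewrite ger0_norm ?invr_ge0 ?ltW// mulVf// gt_eqF.
have pge d : ule p d -> 1 <= d.
  move=> /(uleZ l); rewrite -gl -gE => /rnorm_ule.
  by rewrite -/l gtr0_norm// -{1}[l]mulr1 ler_pM2l.
(* The left inverse [r] bounds [y + l] from below, with a constant read off its two components. *)
have key (w : D) : rnorm w <= C * rnorm (y ** w + l%:C *: w).
  rewrite !rnorm_val; set w' := csub_val (y ** w + _).
  have e : csub_val w = r.1 ** w' + r.2 *: w'.
    have : r * ((uinj (csub_val y) - (- l)%:C *: (1 : unitization B)) * uinj (csub_val w)) = uinj (csub_val w).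
      by rewrite mulrA hr mul1r.
    have -> : (uinj (csub_val y) - (- l)%:C *: (1 : unitization B)) * uinj (csub_val w) = uinj w'.
      congr pair; last by rewrite /= mulr0.
      rewrite /= /w' csub_valD csub_valZ scale0r addr0 scaler0 subr0 sub0r.
      by rewrite -[_ *: 1]/(_ * 1) mulr1 rmorphN opprK.
    by move=> [+ _]; rewrite /= scale0r addr0 => /esym.
  rewrite {1}e mulrDl; apply: le_trans (rnormD _ _) _.
  by apply: lerD; [exact: rnormM|rewrite rnormZ].
have C0 : 0 <= C by rewrite addr_ge0 ?rnorm_ge0 ?cabs_ge0.
(* Chosen so that [C l / (N + 1) < 1], which contradicts the lower bound [1] on the norm of
   [w = p^(N + 1)]. *)
pose N := Num.Def.truncn (C * l).
have hN : C * l < N.+1%:R by exact: truncnS_gt.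
pose w : D := (p ^+ N.+1).1.
have p2 : p.2 = 0 by rewrite -[RHS](mulr0 l^-1%:C) -g20.
have wE : cinj hS w = p ^+ N.+1 by apply: cinj1; rewrite exprS -[RHS](mul0r (p ^+ N).2) -p2.
have w'E : cinj hS (y ** w + l%:C *: w) = ccst hS l * (p ^+ N.+1 * (1 - p)).
  rewrite raddfD /= cinjM.
  have -> : cinj hS (l%:C *: w) = ccst hS l * cinj hS w.
    by apply: cunit_eq; rewrite /= ?mulr0// cmul0x scaler0 !add0r.
  have -> : cinj hS y = f - g by rewrite /g; ring.
  have hfp : f * p = 0 by rewrite /p mulrCA h3 mulr0.
  rewrite wE exprS; exact: mul_sub_eigen.
have w1 : 1 <= rnorm w.
  apply: (@ule_pow_ge1 p _ _ _ _ N.+1) => //; first exact: upos_sa.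
  by rewrite -wE; exact: ule_inj.
have w2 : rnorm (y ** w + l%:C *: w) <= l * N.+1%:R^-1.
  apply: (@rnorm_ule _ _ hS); rewrite w'E -{2}(gtr0_norm g0).
  by apply: uleZ; exact: ule_pow_sub.
have := le_trans w1 (le_trans (key w) (ler_wpM2l C0 w2)).
by rewrite mulrA ler_pdivlMr// mul1r leNgt hN.
Qed.

End SpectralPermanence.

(** * Bicommutants and closedness of the range *)

Lemma closed_rnorm {R : realType} {V : normedModType R[i]} (S : set V) :
  (forall l, (forall e : R, 0 < e -> exists2 x, S x & rnorm (x - l) < e) -> S l) ->
  closed S.
Proof.
move=> hS l cl; apply: hS => e e0.
have [|x [Sx lx]] := cl (ball l e%:C).
  by apply: nbhsx_ballx; rewrite ltcR.
exists x => //; move: lx.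
by rewrite -ball_normE /ball_ /= -rnormE ltcR rnormBC.
Qed.

Section Commutant.
Context {R : realType} {B : cstarAlgType R}.
Implicit Types (X : set B) (x y : B).

Definition commutant X : set B := [set y | forall x, X x -> y ** x = x ** y].

Lemma commutant_closed X : closed (commutant X).
Proof.
apply: closed_rnorm => l hl x Xx.
apply/eqP; rewrite -subr_eq0; apply/eqP; apply: rnorm_eq0.
apply/ler_addgt0Pr => e e0; rewrite add0r.
have d0 : 0 < 2 * rnorm x + 1 by have := rnorm_ge0 x; lra.
have [y yX yl] := hl _ (divr_gt0 e0 d0).
have -> : l ** x - x ** l = x ** (y - l) - (y - l) ** x.
  by rewrite cmulDr cmulDl cmulxN cmulNx (yX x Xx) opprD opprK addrACA subrr add0r addrC.
apply: le_trans (rnormD _ _) _; rewrite rnormN.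
apply: (@le_trans _ _ (rnorm (y - l) * (2 * rnorm x + 1))).
  have := rnormM x (y - l); have := rnormM (y - l) x.
  by have := rnorm_ge0 (y - l); lra.
by rewrite -ler_pdivlMr// ltW.
Qed.

Lemma commutant_star X : (forall x, X x -> X (star x)) ->
  forall y, commutant X y -> commutant X (star y).
Proof.
move=> hX y hy x Xx.
by rewrite -[in LHS](starK x) -starM -hy ?starM ?starK//; exact: hX.
Qed.

Variables (X : set B) (hX : forall x, X x -> X (star x)).

Lemma bicomm0 : commutant (commutant X) 0.
Proof. by move=> x _; rewrite cmul0x cmulx0. Qed.

Lemma bicommD x y : commutant (commutant X) x -> commutant (commutant X) y ->
  commutant (commutant X) (x + y).
Proof. by move=> hx hy z hz; rewrite cmulDl cmulDr hx// hy. Qed.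

Lemma bicommZ (a : R[i]) x : commutant (commutant X) x ->
  commutant (commutant X) (a *: x).
Proof. by move=> hx z hz; rewrite cmulZl cmulZr hx. Qed.

Lemma bicommM x y : commutant (commutant X) x -> commutant (commutant X) y ->
  commutant (commutant X) (x ** y).
Proof. by move=> hx hy z hz; rewrite -cmulA hy// cmulA hx// cmulA. Qed.

Lemma bicomm_star x : commutant (commutant X) x -> commutant (commutant X) (star x).
Proof. by apply: commutant_star; exact: commutant_star. Qed.

(** Commutants are closed from the outset, so this gives a C*-subalgebra around [X] before the range
    of a morphism is known to be closed. *)
Definition bicommutant : cstarSubalg B :=
  CStarSubalg bicomm0 bicommD bicommZ bicommM bicomm_star
    (@commutant_closed (commutant X)).

Lemma sub_bicommutant x : X x -> (bicommutant : set B) x.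
Proof. by move=> Xx y hy; rewrite hy. Qed.

(** A commuting [X] lies in its commutant, hence the bicommutant lies in the commutant too and
    commutes with itself. *)
Lemma bicommutant_comm : (forall x y, X x -> X y -> x ** y = y ** x) ->
  cstar_commutative (csub_alg bicommutant).
Proof.
move=> cX x y; apply: val_inj => /=.
have hx := set_mem (csub_valP x); have hy := set_mem (csub_valP y).
apply: hx => z Xz; apply: hy => w Xw; exact: cX.
Qed.

End Commutant.

(** In the bicommutant of [y], both [y] and [- y] become squares, and squares with sum [0]
    vanish. *)
Lemma cpositive_anti (R : realType) (B : cstarAlgType R) (y : B) :
  cpositive y -> cpositive (- y) -> y = 0.
Proof.
move=> py ny; have [sy _] := py.
have hX x : [set y] x -> [set y] (star x) by move=> ->; exact: sy.
have hS := @bicommutant_comm _ _ _ hX.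
have {}hS : cstar_commutative (csub_alg (bicommutant hX)).
  by apply: hS => _ _ -> ->.
pose z : csub_alg (bicommutant hX) := CSubType (mem_set (sub_bicommutant hX (erefl y))).
have h1 : upos (cinj hS z) by exact: cpositive_upos.
have h2 : upos (cinj hS (- z)).
  have e : csub_val (- z) = - y by exact: (raddfN val).
  by apply: cpositive_upos; rewrite e.
have h3 : cinj hS z + cinj hS (- z) = 0 by rewrite -raddfD subrr raddf0.
have /cinj_inj z0 : cinj hS z = cinj hS 0 by rewrite raddf0; exact: uposD_eq0 h3.
by rewrite -[y]/(csub_val z) z0.
Qed.

Lemma is_csup_unique (R : realType) (B : cstarAlgType R) (u : nat -> B) (s t : B) :
  is_csup u s -> is_csup u t -> s = t.
Proof.
move=> [ss su sl] [ts tu tl].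
apply/eqP; rewrite -subr_eq0; apply/eqP; apply: cpositive_anti; first exact: tl.
by rewrite opprB; exact: sl.
Qed.

(** * Morphisms with restricted codomain *)

Section Corestriction.
Context {R : realType} {A B : cstarAlgType R} (phi : {linear A -> B}).
Context (S : cstarSubalg B) (hS : forall x, (S : set B) (phi x)).

Definition corestr (x : A) : csub_alg S := CSubType (mem_set (hS x)).

Lemma corestr_linear : linear corestr.
Proof.
move=> a x y; apply: val_inj; rewrite [LHS]linearP; apply/esym.
exact: (linearP (val : {linear csub_alg S -> B})).
Qed.

HB.instance Definition _ := GRing.isLinear.Build R[i] A (csub_alg S) *:%R corestr
  corestr_linear.

Lemma corestr_morph : star_morphism phi -> star_morphism corestr.
Proof.
move=> [hM hs]; split=> [x y|x]; apply: val_inj => /=; first exact: hM.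
exact: hs.
Qed.

End Corestriction.

(** * The range of a morphism from a commutative algebra *)

Section Range.
Context {R : realType} {A B : cstarAlgType R} {hA : cstar_commutative A}.
Context (phi : {linear A -> B}) (mphi : star_morphism phi).

Lemma range_star x : range phi x -> range phi (star x).
Proof. by move=> [a _ <-]; exists (star a); rewrite ?(star_morphism_star mphi). Qed.

Lemma range_comm x y : range phi x -> range phi y -> x ** y = y ** x.
Proof.
move=> [a _ <-] [b _ <-]; by rewrite -!(star_morphismM mphi) hA.
Qed.

Local Notation S0 := (bicommutant range_star).

Let S0phi x : (S0 : set B) (phi x).
Proof. by apply: sub_bicommutant; exists x. Qed.

Let cS0 : cstar_commutative (csub_alg S0).
Proof. exact: bicommutant_comm range_comm. Qed.

(** Contractivity into a commutative algebra applies after corestriction to the bicommutant of the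
    range. *)
Lemma rnorm_star_morphism x : rnorm (phi x) <= rnorm x.
Proof.
by apply: (@rnorm_morph _ _ _ hA cS0 (corestr S0phi)); exact: corestr_morph.
Qed.

Lemma sa_lift_norm x c : star x = x -> rnorm (phi x) <= c ->
  phi (clip hA c x) = phi x /\ rnorm (clip hA c x) <= c.
Proof.
move=> sx xc.
have [h1 h2] := @clip_lift _ _ _ hA cS0 (corestr S0phi) (corestr_morph S0phi mphi) c x sx xc.
by split=> //; move/(congr1 (@csub_val _ _ _)) : h1.
Qed.

(** Truncation controls self-adjoint lifts without loss; the factor [2] comes from treating real and
    imaginary parts separately. *)
Lemma lift_norm x : exists2 x', phi x' = phi x & rnorm x' <= 2 * rnorm (phi x).
Proof.
set c := rnorm (phi x).
have half_cabs : cabs (2^-1 : R[i]) = 2^-1.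
  by rewrite -[2^-1 in LHS]/((2 : R[i])^-1) -(rmorph_nat (real_complex R)) -fmorphV cabs_real ger0_norm ?invr_ge0.
have conj_half : (2^-1 : R[i])^* = 2^-1.
  by rewrite conjc_inv conjc_nat.
pose h := (2^-1 : R[i]) *: (x + star x).
pose k := (2^-1 : R[i]) *: ('i *: (star x - x)).
have sh : star h = h by rewrite starZ starD starK conj_half addrC.
have conj_i : ('i : R[i])^* = - 'i by apply/eqP; rewrite eq_complex /= oppr0 !eqxx.
have sk : star k = k.
  by rewrite !starZ starD starN starK conj_half conj_i scaleNr -scalerN opprB.
have xE : x = h + 'i *: k.
  have -> : 'i *: k = - ((2^-1 : R[i]) *: (star x - x)).
    by rewrite /k !scalerA mulrAC -expr2 sqr_i mulN1r scaleNr.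
  rewrite /h -scalerBr opprB addrACA subrr.
  by rewrite addr0 -mulr2n -[x *+ 2]scaler_nat scalerA mulVf ?scale1r// pnatr_eq0.
have nstar : rnorm (phi (star x)) = c by rewrite (star_morphism_star mphi) rnorm_star.
have hh : rnorm (phi h) <= c.
  rewrite linearZ /= linearD rnormZ half_cabs.
  have := rnormD (phi x) (phi (star x)); rewrite nstar -/c; lra.
have hk : rnorm (phi k) <= c.
  rewrite !linearZ /= linearB !rnormZ half_cabs cabs_i.
  have := rnormD (phi (star x)) (- phi x); rewrite rnormN nstar -/c; lra.
have [h1 h2] := sa_lift_norm sh hh.
have [k1 k2] := sa_lift_norm sk hk.
exists (clip hA c h + 'i *: clip hA c k).
  have lin u v : phi (u + 'i *: v) = phi u + 'i *: phi v.
    by rewrite linearD linearZ.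
  by rewrite [in RHS]xE !lin h1 k1.
apply: le_trans (rnormD _ _) _; rewrite rnormZ cabs_i; lra.
Qed.

(** A sequence in the range converging geometrically to [l] is lifted increment by increment with
    norm control; the sums of the lifts converge in [A]. *)
Lemma range_closed : closed (range phi).
Proof.
apply: closed_rnorm => l hl.
pose e n : R := 2^-1 ^+ n.
have e0 n : 0 < e n by rewrite exprn_gt0// invr_gt0.
have eS n : e n = e n.+1 + e n.+1 by rewrite /e exprS; field.
have /choice[x hx] : forall n, exists x, rnorm (phi x - l) < e n.
  by move=> n; have [_ [x _ <-] h] := hl _ (e0 n); exists x.
(* The constant [4] is twice the bound [e n + e n.+1 <= 2 e n] on the increment. *)
have /choice[y hy] : forall n, exists y, phi y = phi (x n.+1 - x n) /\
    rnorm y <= 4 * e n.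
  move=> n; have [y h1 h2] := lift_norm (x n.+1 - x n).
  exists y; split=> //; apply: le_trans h2 _; rewrite linearB /=.
  have -> : phi (x n.+1) - phi (x n) = (phi (x n.+1) - l) + (l - phi (x n)).
    by rewrite addrA subrK.
  have := rnormD (phi (x n.+1) - l) (l - phi (x n)).
  rewrite [rnorm (l - _)]rnormBC; have := hx n; have := hx n.+1; have := eS n.
  by have := e0 n.+1; lra.
pose z n := x 0%N + \sum_(i < n) y i.
have zS n : z n.+1 = z n + y n by rewrite /z big_ord_recr /= addrA.
have pz n : phi (z n) = phi (x n).
  elim: n => [|n ih]; first by rewrite /z big_ord0 addr0.
  by rewrite zS linearD /= ih (hy n).1 linearB /= addrC subrK.
(* Telescoping: [4 e n = 8 e n - 8 e n.+1]. *)
have zz n k : rnorm (z (n + k)%N - z n) <= 8 * e n - 8 * e (n + k)%N.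
  elim: k => [|k ih]; first by rewrite addn0 !subrr rnorm0.
  rewrite addnS zS addrAC; apply: le_trans (rnormD _ _) _.
  by have := (hy (n + k)%N).2; have := eS (n + k)%N; lra.
have e8 : tends0 (fun n => 8 * e n).
  by apply: tends0_geo; rewrite invr_ge0 ler0n/= invf_lt1// ltr1n.
have [n k|w hw] := @rnorm_complete _ A z _ e8.
  by apply: le_trans (zz n k) _; have := e0 (n + k)%N; lra.
exists w => //; apply/eqP; rewrite -subr_eq0; apply/eqP; apply: rnorm_eq0.
apply/ler_addgt0Pr => d d0; rewrite add0r.
have [|N hN] := e8 (d / 2); first by rewrite divr_gt0.
have := hN N (leqnn N) => hN1.
have -> : phi w - l = phi (w - z N) + (phi (x N) - l).
  by rewrite linearB /= pz addrA subrK.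
apply: le_trans (rnormD _ _) _.
have := rnorm_star_morphism (w - z N); rewrite [rnorm (w - _)]rnormBC.
by have := hw N; have := hx N; have := e0 N; lra.
Qed.

Lemma range0 : range phi 0.
Proof. by exists 0; rewrite ?linear0. Qed.

Lemma rangeD x y : range phi x -> range phi y -> range phi (x + y).
Proof. by move=> [a _ <-] [b _ <-]; exists (a + b); rewrite ?linearD. Qed.

Lemma rangeZ (t : R[i]) x : range phi x -> range phi (t *: x).
Proof. by move=> [a _ <-]; exists (t *: a); rewrite ?linearZ. Qed.

Lemma rangeM x y : range phi x -> range phi y -> range phi (x ** y).
Proof.
by move=> [a _ <-] [b _ <-]; exists (a ** b); rewrite ?(star_morphismM mphi).
Qed.

Definition range_subalg : cstarSubalg B :=
  CStarSubalg range0 rangeD rangeZ rangeM range_star range_closed.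

Lemma range_subalg_comm : cstar_commutative (csub_alg range_subalg).
Proof.
move=> x y; apply: val_inj => /=; apply: range_comm.
  exact: set_mem (csub_valP x).
exact: set_mem (csub_valP y).
Qed.

End Range.

(** * Lifting increasing sequences *)

Lemma bounded_funP {R : realType} {V : normedModType R[i]} (u : nat -> V) :
  bounded_fun u <-> exists c : R, forall n, rnorm (u n) <= c.
Proof.
split=> [[M [Mr hM]]|[c hc]].
  exists (complex.Re M + 1) => n.
  have MR : M = (complex.Re M)%:C by rewrite RRe_real.
  have := hM (complex.Re M + 1)%:C; rewrite {1}MR ltcR ltrDl ltr01 => /(_ isT n I).
  by rewrite /= -rnormE lecR.
exists c%:C; split; first by apply/complex_realP; exists c.
move=> M cM n _; rewrite /= -rnormE; apply: le_trans (ltW cM).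
by rewrite lecR.
Qed.

Section Lifting.
Context {R : realType} {A B : cstarAlgType R} {hA : cstar_commutative A}.
Context (phi : {linear A -> B}) (mphi : star_morphism phi).
Local Notation S := (@range_subalg _ _ _ hA _ mphi).

Lemma range_phi x : (S : set B) (phi x).
Proof. by exists x. Qed.

Lemma range_cpositive_upos x : cpositive (phi x) ->
  upos (cinj (range_subalg_comm (hA := hA) (mphi := mphi)) (corestr range_phi x)).
Proof. by move=> h; apply: cpositive_upos. Qed.

Lemma sa_lift y : range phi y -> star y = y ->
  exists2 x, star x = x & phi x = y.
Proof.
move=> [x _ <-] sy.
have conj_half : (2^-1 : R[i])^* = 2^-1 by rewrite conjc_inv conjc_nat.
exists ((2^-1 : R[i]) *: (x + star x)).
  by rewrite starZ starD starK conj_half addrC.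
rewrite linearZ linearD /= (star_morphism_star mphi) sy -mulr2n.
by rewrite -[phi x *+ 2]scaler_nat scalerA mulVf ?scale1r// pnatr_eq0.
Qed.

(** The positive part of a self-adjoint lift stays in [A], its character being [0], and by
    [umap_ppart] it has the same image. *)
Lemma positive_lift y : range phi y -> cpositive y ->
  exists2 x, upos (cinj hA x) & phi x = y.
Proof.
move=> ry py; have [sy _] := py; have [x sx xy] := sa_lift ry sy.
rewrite -xy in py; have hy := range_cpositive_upos py.
have sX : cstar (cinj hA x) = cinj hA x by rewrite cstar_inj sx.
have [h1 _ _] := ppartP sX.
have pE : cinj hA (ppart (cinj hA x)).1 = ppart (cinj hA x).
  by apply: cinj1; rewrite (@ppart_snd _ _ _ _ 0)// maxxx.
exists (ppart (cinj hA x)).1; first by rewrite pE.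
have := umap_ppart (corestr_morph range_phi mphi) sX hy.
by move=> /(congr1 fst) /(congr1 (@csub_val _ _ _)) /= ->.
Qed.

Lemma increasing_lift (u : nat -> B) : (forall n, range phi (u n)) ->
  bounded_increasing_sa u ->
  exists2 a : nat -> A, bounded_increasing_sa a & forall n, phi (a n) = u n.
Proof.
move=> ru [su iu /bounded_funP[c hc]].
have [x0 sx0 x0u] := sa_lift (ru 0%N) (su 0%N).
have /choice[d hd] : forall n, exists x, upos (cinj hA x) /\ phi x = u n.+1 - u n.
  move=> n; have [|x h1 h2] := positive_lift _ (iu n); last by exists x.
  have [[y _ <-] [z _ <-]] := (ru n.+1, ru n).
  by exists (y - z); rewrite ?linearB.
pose m n := x0 + \sum_(i < n) d i.
have mS n : m n.+1 = m n + d n by rewrite /m big_ord_recr /= addrA.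
have mu n : phi (m n) = u n.
  elim: n => [|n ih]; first by rewrite /m big_ord0 addr0.
  by rewrite mS linearD /= ih (hd n).2 addrC subrK.
have sd n : star (d n) = d n.
  by apply: (@cinj_inj _ _ hA); rewrite -cstar_inj upos_sa//; have [] := hd n.
have sm n : star (m n) = m n.
  elim: n => [|n ih]; first by rewrite /m big_ord0 addr0.
  by rewrite mS starD ih sd.
have c0 : 0 <= c by apply: le_trans (hc 0%N); exact: rnorm_ge0.
(* The sums [m n] increase but need not be bounded. Truncation at [c], a bound for [u], keeps them
   increasing and leaves their images unchanged. *)
have lift n : phi (clip hA c (m n)) = phi (m n) /\ rnorm (clip hA c (m n)) <= c.
  by apply: sa_lift_norm => //; rewrite mu.
have sM n : cstar (cinj hA (m n)) = cinj hA (m n) by rewrite cstar_inj sm.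
exists (fun n => clip hA c (m n)); last by move=> n; rewrite (lift n).1 mu.
split=> [n|n|].
- apply: (@cinj_inj _ _ hA); rewrite -cstar_inj clipE//.
  exact: clipU_sa.
- apply: (@upos_cpositive _ _ hA); rewrite raddfB /= !clipE//.
  apply: clipU_mono => //; rewrite mS raddfD /= addrAC subrr add0r.
  by have [] := hd n.
- by apply/bounded_funP; exists c => n; have [] := lift n.
Qed.

End Lifting.

(** * Suprema of increasing sequences in the range *)

Theorem theorem2p2 (R : realType) (A B : cstarAlgType R)
    (phi : {linear A -> B})
    (hcomm : cstar_commutative A)
    (hsup : monotone_sigma_complete A)
    (hmor : star_morphism phi)
    (hnorm : sigma_normal phi) :
  exists S : cstarSubalg B,
    [/\ (S : set B) = range phi,
        cstar_commutative (csub_alg S),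
        monotone_sigma_complete (csub_alg S) &
        monotone_sigma_closed S].
Proof.
pose S := @range_subalg _ _ _ hcomm _ hmor.
pose psi := corestr (range_phi (hA := hcomm) hmor).
have mval : star_morphism (val : {linear csub_alg S -> B}) by [].
(* From the order of [S] to that of [B], where [sigma_normal] speaks. *)
have val_le (x y : csub_alg S) : cle x y -> cle (csub_val x) (csub_val y).
  by move=> /(cpositive_morph mval); rewrite linearB.
exists S; split=> //; first exact: range_subalg_comm.
  move=> u [su iu /bounded_funP[c hc]].
  have ru n : range phi (csub_val (u n)) by exact: set_mem (csub_valP (u n)).
  have bu : bounded_increasing_sa (fun n => csub_val (u n)).
    split=> [n|n|]; first exact: (congr1 (@csub_val _ _ _) (su n)).
      exact: val_le.
    by apply/bounded_funP; exists c.
  have [a ba au] := increasing_lift (hA := hcomm) hmor ru bu.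
  have [s as_] := hsup _ ba.
  have psia n : psi (a n) = u n by apply: val_inj; exact: au.
  have [_ _ sl] := hnorm _ _ ba as_.
  have mpsi := corestr_morph (range_phi (hA := hcomm) hmor) hmor.
  have [ss us _] := as_.
  exists (psi s); split=> [|n|t st ut].
  - by rewrite /selfadjoint -(star_morphism_star mpsi) ss.
  - rewrite -psia /cle -[psi s - _](linearB (corestr (range_phi (hA := hcomm) hmor))).
    exact: cpositive_morph (us n).
  (* The supremum property holds in [B]; the inequality returns to the order of [S] through
     squares. *)
  - have : cle (phi s) (csub_val t).
      apply: sl; first exact: (congr1 (@csub_val _ _ _) st).
      by move=> n; rewrite /= au; exact: val_le.
    have -> : cle (phi s) (csub_val t) = cpositive (csub_val (t - psi s)).
      by rewrite csub_valB.
    by move=> /(cpositive_upos (hS := range_subalg_comm (hA := hcomm) (mphi := hmor))) /upos_cpositive.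
(* The supremum in [B] is identified, by uniqueness, with the image of the supremum of a lifted
   sequence. *)
move=> u s ru bu us.
have [a ba au] := increasing_lift (hA := hcomm) hmor ru bu.
have [t ta] := hsup _ ba.
exists t => //; apply: is_csup_unique us.
suff -> : u = phi \o a by exact: hnorm.
by apply/funext => n; rewrite /= au.
Qed.
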